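(* Let $\mathbb{F}$ be a field of characteristic zero and let $A$ be an algebra of Jordan type half over $\mathbb{F}$. Then either $A$ contains infinitely many primitive axes of Jordan type half, or $A$ is isomorphic to a Matsuo algebra $M_{1/2}(G,D)$ or to a factor algebra (quotient by an ideal) of such a Matsuo algebra.
   Context: All algebras are commutative but not necessarily associative. For $x$ in an algebra $A$, $A_\lambda(x)=\{u\in A:xu=\lambda u\}$. A primitive axis of Jordan type half is $x\neq0$ with $x^2=x$, $A=A_1(x)\oplus A_0(x)\oplus A_{1/2}(x)$, $A_1(x)=\mathbb{F}x$, and fusion rules $A_1A_1\subseteq A_1$, $A_1A_0=0$, $A_0A_0\subseteq A_0$, $A_1A_{1/2}\subseteq A_{1/2}$, $A_0A_{1/2}\subseteq A_{1/2}$, $A_{1/2}A_{1/2}\subseteq A_1\oplus A_0$ (eigenspaces of $x$). An algebra of Jordan type half is a commutative algebra generated by primitive axes of Jordan type half. A $3$-transposition group $(G,D)$ is a group $G$ with a conjugacy-invariant set $D$ of involutions generating $G$ such that $cd$ has order at most $3$ for all $c,d\in D$. The Matsuo algebra $M_{1/2}(G,D)$ over $\mathbb{F}$ has basis $D$ and product $c\cdot c=c$, $c\cdot d=0$ if $cd$ has order $2$, and $c\cdot d=\frac14(c+d-e)$ if $cd$ has order $3$, where $e=c^d=d^c$. *)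

(* Defs.v *)
From HB Require Import structures.
From mathcomp Require Import all_boot all_order all_algebra all_fingroup.
Set Implicit Arguments. Unset Strict Implicit. Unset Printing Implicit Defensive.
Import GRing.Theory.
Local Open Scope ring_scope.

Section Alg.
Variables (F : fieldType) (V : lmodType F) (mul : V -> V -> V).

(* mul is a commutative bilinear product (linearity in the second argument
   follows from commutativity). *)
Definition comm_algebra : Prop :=
  (forall x y, mul x y = mul y x) /\
  (forall (a : F) x y z, mul (a *: x + y) z = a *: mul x z + mul y z).

Definition eigensp (x : V) (l : F) (u : V) : Prop := mul x u = l *: u.

Definition half : F := (2%:R)^-1.

Definition primitive_axis_half (x : V) : Prop :=
  [/\ x != 0, mul x x = x,
  (forall u, exists u1 u0 uh,
      [/\ eigensp x 1 u1, eigensp x 0 u0, eigensp x half uh & u = u1 + u0 + uh])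
  /\
  (forall u1 u0 uh, eigensp x 1 u1 -> eigensp x 0 u0 -> eigensp x half uh ->
      u1 + u0 + uh = 0 -> [/\ u1 = 0, u0 = 0 & uh = 0]),
  (forall u, eigensp x 1 u <-> exists a : F, u = a *: x)
  &
  [/\ (forall u v, eigensp x 1 u -> eigensp x 1 v -> eigensp x 1 (mul u v)),
      (forall u v, eigensp x 1 u -> eigensp x 0 v -> mul u v = 0),
      (forall u v, eigensp x 0 u -> eigensp x 0 v -> eigensp x 0 (mul u v))
    & (forall u v, eigensp x 1 u -> eigensp x half v -> eigensp x half (mul u v))] /\
  [/\
(forall u v, eigensp x 0 u -> eigensp x half v -> eigensp x half (mul u v))
    & (forall u v, eigensp x half u -> eigensp x half v ->
         exists w1 w0, [/\ eigensp x 1 w1, eigensp x 0 w0 & mul u v = w1 + w0])]].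

Definition subspace (S : V -> Prop) : Prop :=
  [/\ S 0, (forall x y, S x -> S y -> S (x + y)) & (forall (a : F) x, S x -> S (a *: x))].

Definition subalgebra (S : V -> Prop) : Prop :=
  subspace S /\ (forall x y, S x -> S y -> S (mul x y)).

Definition ideal (I : V -> Prop) : Prop :=
  subspace I /\ (forall x y, I y -> I (mul x y)).

Definition jordan_half_algebra : Prop :=
  comm_algebra /\
  (forall S, subalgebra S -> (forall x, primitive_axis_half x -> S x) -> forall u, S u).

Definition infinitely_many_axes : Prop :=
  ~ exists s : seq V, forall x, primitive_axis_half x -> x \in s.

End Alg.

Definition alg_hom (F : fieldType) (V W : lmodType F)
    (mulV : V -> V -> V) (mulW : W -> W -> W) (phi : V -> W) : Prop :=
  (forall (a : F) x y, phi (a *: x + y) = a *: phi x + phi y) /\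
  (forall x y, phi (mulV x y) = mulW (phi x) (phi y)).

Definition alg_isomorphic (F : fieldType) (V W : lmodType F)
    (mulV : V -> V -> V) (mulW : W -> W -> W) : Prop :=
  exists phi : V -> W, alg_hom mulV mulW phi /\ bijective phi.

(* W is isomorphic to the factor algebra V/I, I an ideal of V:
   there is a surjective algebra homomorphism V -> W with kernel exactly I. *)
Definition alg_factor_iso (F : fieldType) (V W : lmodType F)
    (mulV : V -> V -> V) (mulW : W -> W -> W) (I : V -> Prop) : Prop :=
  ideal mulV I /\
  exists phi : V -> W, [/\ alg_hom mulV mulW phi,
                          (forall w, exists v, phi v = w) &
                          (forall v, phi v = 0 <-> I v)].

Definition three_transposition (gT : finGroupType) (G : {group gT}) (D : {set gT}) : Prop :=
  [/\ D \subset G, <<D>>%g = G :> {set gT},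
      (forall d, d \in D -> #[d]%g = 2%N),
      (forall d g, d \in D -> g \in G -> (d ^ g)%g \in D)
    & (forall c d, c \in D -> d \in D -> (#[(c * d)%g]%g <= 3)%N)].

Section Matsuo.
Variables (F : fieldType) (gT : finGroupType) (D : {set gT}).

Definition Dt : finType := {x : gT | x \in D}.

Definition matsuo_space : lmodType F := {ffun Dt -> F^o}.

(* the basis vector indexed by g (zero if g \notin D) *)
Definition mbasis (g : gT) : matsuo_space := [ffun y : Dt => ((val y == g)%:R : F^o)].

Definition matsuo_basis_prod (c d : Dt) : matsuo_space :=
  if c == d then mbasis (val c)
  else if #[(val c * val d)%g]%g == 2%N then 0
  else if #[(val c * val d)%g]%g == 3%N then
    (4%:R : F)^-1 *: (mbasis (val c) + mbasis (val d) - mbasis (val c ^ val d)%g)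
  else 0.

Definition matsuo_mul (f g : matsuo_space) : matsuo_space :=
  \sum_(c : Dt) \sum_(d : Dt) (f c * g d) *: matsuo_basis_prod c d.

End Matsuo.

(* Main.v *)
Require Import Defs.
From HB Require Import structures.
From mathcomp Require Import all_boot all_order all_algebra all_fingroup.
From mathcomp Require Import cyclic ring boolp classical_sets.
Set Implicit Arguments. Unset Strict Implicit. Unset Printing Implicit Defensive.
Import GRing.Theory.
Local Open Scope ring_scope.

(* For an axis [a] let [tau a] be its Miyamoto involution and [psi a v] the
   coefficient of [a] in the Peirce decomposition of [v].  The algebra is spanned
   by its axes, [psi a b] is symmetric on axes, and the product of two axes [a]
   and [b] is determined by [psi a b], [a], [b] and [tau a b].

   If [a != b] and [psi a b = 1], or [a b != 0] and [psi a b = 0], then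
   [rho = tau b \o tau a] is unipotent and the axes [rho ^ n a] are distinct.
   If [psi a b = (1 + c) / 2] with [c] not in {1, -1, -1/2}, then [a] and [b] lie
   in a spin factor with unit [e] and unit vectors [u0], [u1] at angle [theta],
   [c = cos theta].  With [z] a formal [exp (i theta)], [rho] acts with eigenvalues
   [z ^ 2] and [z ^ -2] on the plane of [u0] and [u1], and with eigenvalues
   1, [z] and [z ^ -1] on the rest, which gives a grading of the algebra by
   weights between -2 and 2 (for [c = -1/2] it fails, since then [z ^ 3 = 1]).
   The rational points of the corresponding torus of automorphisms move [a] to
   infinitely many axes.

   So if there are finitely many axes, any two axes satisfy [a = b], [a b = 0] or
   [psi a b = 1/4].  In the last case [tau a b = tau b a = a + b - 4 a b], which
   is the Matsuo relation, and the reflections [tau] generate a 3-transposition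
   group on the set of axes. *)

(** * Linear combinations in a module *)

Section ModuleReflection.
Variables (F : fieldType) (V : lmodType F).

Inductive mexp := MZero | MVar of nat | MAdd of mexp & mexp | MOpp of mexp
  | MScale of F & mexp.

Fixpoint meval (env : seq V) e : V := match e with
  | MZero => 0
  | MVar n => nth 0 env n
  | MAdd e1 e2 => meval env e1 + meval env e2
  | MOpp e1 => - meval env e1
  | MScale k e1 => k *: meval env e1
  end.

Fixpoint mcoef e n : F := match e with
  | MZero => 0
  | MVar m => if Nat.eqb m n then 1 else 0
  | MAdd e1 e2 => mcoef e1 n + mcoef e2 n
  | MOpp e1 => - mcoef e1 n
  | MScale k e1 => k * mcoef e1 n
  end.

Fixpoint mcoef_eq n e1 e2 : Prop := match n with
  | 0%N => True
  | m.+1 => mcoef e1 m = mcoef e2 m /\ mcoef_eq m e1 e2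
  end.

Lemma meval_coef env e :
  meval env e = \sum_(i < size env) mcoef e i *: nth 0 env i.
Proof.
elim: e => [|n|e1 IH1 e2 IH2|e IH|k e IH] /=.
- by rewrite big1 // => i _; rewrite scale0r.
- have eqb m : Nat.eqb n m = (n == m) by elim: n m => [|n IHn] [|m] //=; rewrite IHn.
  case: (ltnP n (size env)) => [ltn|len].
    rewrite (bigD1 (Ordinal ltn)) //= eqb eqxx scale1r big1 ?addr0 // => i.
    by rewrite eqb -val_eqE /= eq_sym => /negPf->; rewrite scale0r.
  rewrite nth_default // big1 // => i _; rewrite eqb.
  by rewrite gtn_eqF ?scale0r // (leq_trans (ltn_ord i)).
- by rewrite IH1 IH2 -big_split; apply: eq_bigr => i _; rewrite scalerDl.
- by rewrite IH -sumrN; apply: eq_bigr => i _; rewrite scaleNr.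
- by rewrite IH scaler_sumr; apply: eq_bigr => i _; rewrite scalerA.
Qed.

Lemma meval_eq env e1 e2 :
  mcoef_eq (size env) e1 e2 -> meval env e1 = meval env e2.
Proof.
rewrite !meval_coef; elim: (size env) => [|n IH] /=; first by rewrite !big_ord0.
by case=> E H; rewrite !big_ord_recr /= E IH.
Qed.

Lemma linear_combination1 (l r e1 e2 : V) (k : F) :
  l = r -> e1 - e2 = k *: (l - r) -> e1 = e2.
Proof. by move=> -> /eqP; rewrite subrr scaler0 subr_eq0 => /eqP. Qed.

Lemma linear_combination2 (l r l' r' e1 e2 : V) (k k' : F) : l = r -> l' = r' ->
  e1 - e2 = k *: (l - r) + k' *: (l' - r') -> e1 = e2.
Proof. by move=> -> -> /eqP; rewrite !subrr !scaler0 addr0 subr_eq0 => /eqP. Qed.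

Lemma scaler_cancel (k : F) (x : V) : k != 0 -> k *: x = 0 -> x = 0.
Proof. by move=> k0 /eqP; rewrite scaler_eq0 (negPf k0) => /eqP. Qed.

End ModuleReflection.

Ltac matom_index x env :=
  lazymatch env with
  | x :: _ => constr:(0%N)
  | _ :: ?t => let n := matom_index x t in constr:(S n)
  end.

Ltac matoms env e :=
  lazymatch e with
  | 0 => env
  | ?a + ?b => let env1 := matoms env a in matoms env1 b
  | - ?a => matoms env a
  | ?k *: ?a => matoms env a
  (* [matom_index] fails on an atom not yet in [env]; [match] then backtracks to the branch that
     adds it. *)
  | ?x => match env with
          | _ => let n := matom_index x env in env
          | _ => constr:(x :: env)
          end
  end.

Ltac mreify F env e :=
  lazymatch e with
  | 0 => constr:(@MZero F)
  | ?a + ?b => let e1 := mreify F env a in let e2 := mreify F env b in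
               constr:(MAdd e1 e2)
  | - ?a => let e1 := mreify F env a in constr:(MOpp e1)
  | ?k *: ?a => let e1 := mreify F env a in constr:(@MScale F k e1)
  | ?x => let n := matom_index x env in constr:(@MVar F n)
  end.

(* Reduces an equation between linear combinations of vectors to the equality
   of the coefficients of each vector occurring in it. *)
Ltac mcoefs F :=
  lazymatch goal with
  | |- @eq ?V ?l ?r =>
    let env0 := matoms (@nil V) l in
    let env := matoms env0 r in
    let e1 := mreify F env l in
    let e2 := mreify F env r in
    apply: (@meval_eq F _ env e1 e2);
    cbn [size mcoef_eq mcoef Nat.eqb];
    repeat apply: conj; try exact: I
  end.

(** * Axes and Miyamoto involutions *)

Definition lin (F : fieldType) (V : lmodType F) (f : V -> V) :=
  forall k x y, f (k *: x + y) = k *: f x + f y.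

Lemma linE (F : fieldType) (V : lmodType F) (f : V -> V) : lin f ->
  ((f 0 = 0)%R * (forall x y, f (x + y) = f x + f y)%R *
   (forall x, f (- x) = - f x)%R * (forall k x, f (k *: x) = k *: f x)%R)%type.
Proof.
move=> Hf.
have D x y : f (x + y) = f x + f y by rewrite -[x]scale1r Hf !scale1r.
have f0 : f 0 = 0 by apply: (@addrI _ (f 0)); rewrite -D !addr0.
have Z k x : f (k *: x) = k *: f x by rewrite -[k *: x]addr0 Hf f0 addr0.
have N x : f (- x) = - f x by rewrite -scaleN1r Z scaleN1r.
exact: (f0, D, N, Z).
Qed.

Lemma lin_comp (F : fieldType) (V : lmodType F) (f g : V -> V) :
  lin f -> lin g -> lin (fun v => f (g v)).
Proof. by move=> Hf Hg k x y; rewrite Hg Hf. Qed.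

Lemma natF_neq0 (F : fieldType) (charF0 : [pchar F] =i pred0) n :
  n.+1%:R != 0 :> F.
Proof. by have /pcharf0P->  := charF0. Qed.

Section Axes.
Variables (F : fieldType) (V : lmodType F) (mul : V -> V -> V).
Hypothesis charF0 : [pchar F] =i pred0.
Hypothesis mulA : comm_algebra mul.
Local Notation "x ** y" := (mul x y) (at level 40, left associativity).
Local Notation axis := (primitive_axis_half mul).
Local Notation natF0 := (natF_neq0 charF0).
Local Ltac ff := try by [field; rewrite ?natF0 | ring].
Local Ltac mc := mcoefs F; ff.

Lemma mulC x y : x ** y = y ** x. Proof. by case: mulA. Qed.

Lemma lin_mul x : lin (mul x).
Proof. by case: mulA => C L k y z; rewrite !(C x) L. Qed.

Lemma mulE : ((forall x, 0 ** x = 0)%R * (forall x, x ** 0 = 0)%R *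
  (forall x y z, (x + y) ** z = x ** z + y ** z)%R *
  (forall x y z, z ** (x + y) = z ** x + z ** y)%R *
  (forall x y, (- x) ** y = - (x ** y))%R *
  (forall x y, x ** (- y) = - (x ** y))%R *
  (forall k x y, (k *: x) ** y = k *: (x ** y))%R *
  (forall k x y, x ** (k *: y) = k *: (x ** y))%R)%type.
Proof.
have L x := linE (lin_mul x).
have R0 x : 0 ** x = 0 by rewrite mulC L.
have RD x y z : (x + y) ** z = x ** z + y ** z by rewrite mulC L !(mulC z).
have RN x y : (- x) ** y = - (x ** y) by rewrite mulC L (mulC y).
have RZ k x y : (k *: x) ** y = k *: (x ** y) by rewrite mulC L (mulC y).
exact: (R0, fun x => (L x).1.1.1, RD, fun x y z => (L z).1.1.2 x y, RN,
  fun x y => (L x).1.2 y, RZ, fun k x y => (L x).2 k y).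
Qed.

(* On the eigenvalues 1, 0, 1/2 of [mul a], the polynomial [1 - 8 X + 8 X ^ 2]
   takes the values 1, 1, -1, and [2 X ^ 2 - X] the values 1, 0, 0.
   [tau] is locked so that unification never sees [tau a v] as a sum. *)
Definition tau a v := locked (v - 8%:R *: (a ** v) + 8%:R *: (a ** (a ** v))).

Lemma tau_def a v : tau a v = v - 8%:R *: (a ** v) + 8%:R *: (a ** (a ** v)).
Proof. by rewrite [LHS]/tau -lock. Qed.

(** For an axis [a] exactly one [k] qualifies, so the default 0 matters only when [a] is not an
    axis. *)
Definition psi a v : F :=
  xget 0 [set k : F | 2%:R *: (a ** (a ** v)) - a ** v = k *: a].

Lemma axis_neq0 a : axis a -> a != 0. Proof. by case. Qed.
Lemma axis_idem a : axis a -> a ** a = a. Proof. by case. Qed.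

Lemma axis_split a v : axis a -> exists k v0 vh,
  [/\ a ** v0 = 0, a ** vh = Defs.half F *: vh & v = k *: a + v0 + vh].
Proof.
case=> _ _ [dec _] one _; have [u1 [u0 [uh [/one[k ->] E0 Eh ->]]]] := dec v.
by exists k, u0, uh; split=> //; rewrite E0 scale0r.
Qed.

Lemma psi_unique a v k : axis a ->
  2%:R *: (a ** (a ** v)) - a ** v = k *: a -> psi a v = k.
Proof.
move=> Ha E; rewrite /psi; apply: xget_unique => //= l; rewrite E => /eqP.
rewrite -subr_eq0 -scalerBl scaler_eq0 (negPf (axis_neq0 Ha)) orbF subr_eq0.
by move=> /eqP.
Qed.

Lemma psi_split a k v0 vh : axis a -> a ** v0 = 0 -> a ** vh = Defs.half F *: vh ->
  psi a (k *: a + v0 + vh) = k.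
Proof.
move=> Ha E0 Eh; apply: psi_unique => //.
by rewrite !(mulE, axis_idem Ha, E0, Eh) /Defs.half; mc.
Qed.

Lemma tau_split a k v0 vh : axis a -> a ** v0 = 0 -> a ** vh = Defs.half F *: vh ->
  tau a (k *: a + v0 + vh) = k *: a + v0 - vh.
Proof.
move=> Ha E0 Eh; rewrite !tau_def !(mulE, axis_idem Ha, E0, Eh) /Defs.half; mc.
Qed.

Lemma psiP a v : axis a -> 2%:R *: (a ** (a ** v)) - a ** v = psi a v *: a.
Proof.
move=> Ha; have [k [v0 [vh [E0 Eh ->]]]] := axis_split v Ha.
by rewrite psi_split // !(mulE, axis_idem Ha, E0, Eh) /Defs.half; mc.
Qed.

(** [v - tau a v] is twice the component of [v] in A_1/2, on which [a] acts as 1/2. *)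
Lemma mul_axis a v : axis a -> a ** v = psi a v *: a + 4%:R^-1 *: (v - tau a v).
Proof. by move=> Ha; rewrite -psiP // !tau_def; mc. Qed.

Lemma tau_axis a v : axis a -> tau a v = v + 4%:R *: (psi a v *: a - a ** v).
Proof. by move=> Ha; rewrite -psiP // !tau_def; mc. Qed.

Lemma psi_linear a k x y : axis a -> psi a (k *: x + y) = k * psi a x + psi a y.
Proof.
move=> Ha; apply: psi_unique => //.
by rewrite scalerDl -scalerA -!psiP // !mulE; mc.
Qed.

Lemma psiE a : axis a ->
  ((psi a 0 = 0)%R * (forall x y, psi a (x + y) = psi a x + psi a y)%R *
   (forall x, psi a (- x) = - psi a x)%R *
   (forall k x, psi a (k *: x) = k * psi a x)%R)%type.
Proof.
move=> Ha; have P := fun k x y => psi_linear k x y Ha.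
have D x y : psi a (x + y) = psi a x + psi a y by rewrite -[x]scale1r P scale1r mul1r.
have f0 : psi a 0 = 0 by apply: (@addrI _ (psi a 0)); rewrite -D !addr0.
have Z k x : psi a (k *: x) = k * psi a x by rewrite -[k *: x]addr0 P f0 addr0.
have N x : psi a (- x) = - psi a x by rewrite -scaleN1r Z mulN1r.
exact: (f0, D, N, Z).
Qed.

Lemma tau_self a : axis a -> tau a a = a.
Proof. by move=> Ha; rewrite !tau_def !(axis_idem Ha); mc. Qed.

Lemma lin_tau a : lin (tau a).
Proof. by move=> k x y; rewrite !tau_def !mulE; mc. Qed.

Lemma tauK a : axis a -> cancel (tau a) (tau a).
Proof.
move=> Ha v; have [k [v0 [vh [E0 Eh ->]]]] := axis_split v Ha.
rewrite tau_split // tau_split ?opprK //.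
by rewrite mulE Eh; mc.
Qed.

Lemma psi_tau a v : axis a -> psi a (tau a v) = psi a v.
Proof.
move=> Ha; have [k [v0 [vh [E0 Eh ->]]]] := axis_split v Ha.
by rewrite tau_split // !psi_split // mulE Eh; mc.
Qed.

(** The fusion rules grade the algebra by Z/2, with even part A_1 + A_0 and odd part A_1/2; [tau a]
    is the sign of this grading. *)
Lemma tau_mul a u v : axis a -> tau a (u ** v) = tau a u ** tau a v.
Proof.
move=> Ha; have [k [u0 [uh [E0 Eh ->]]]] := axis_split u Ha.
have [l [v0 [vh [H0 Hh ->]]]] := axis_split v Ha.
rewrite !tau_split //.
have [_ _ _ one [[_ _ f00 _] [f0h fhh]]] := Ha.
have e0 w : a ** w = 0 -> eigensp mul a 0 w by rewrite /eigensp scale0r.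
have e0V w : eigensp mul a 0 w -> a ** w = 0 by rewrite /eigensp scale0r.
have [w1 [w0 [/one[m m1] /e0V W0 W]]] := fhh _ _ Eh Hh.
have B00 := e0V _ (f00 _ _ (e0 _ E0) (e0 _ H0)).
have B0h := f0h _ _ (e0 _ E0) Hh.
have Bh0 := f0h _ _ (e0 _ H0) Eh.
rewrite /eigensp in B0h Bh0.
have E : (k *: a + u0 + uh) ** (l *: a + v0 + vh) =
  (k * l + m) *: a + (u0 ** v0 + w0) +
  (k * Defs.half F *: vh + l * Defs.half F *: uh + u0 ** vh + v0 ** uh).
  rewrite !(mulE, axis_idem Ha, E0, Eh, H0, Hh, W) m1.
  by rewrite !(mulC _ a) E0 Eh (mulC uh v0); mc.
rewrite E tau_split //; last 2 first.
- by rewrite !mulE B00 W0 addr0.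
- by rewrite !mulE B0h Bh0 Eh Hh; mc.
rewrite !(mulE, axis_idem Ha, E0, Eh, H0, Hh, W) m1.
by rewrite !(mulC _ a) E0 Eh (mulC uh v0); mc.
Qed.

(** Both factors lie in A_0, which is closed under products. *)
Lemma psi_mul_fixed a u v : axis a -> tau a u = u -> tau a v = v ->
  psi a u = 0 -> psi a v = 0 -> psi a (u ** v) = 0.
Proof.
move=> Ha Tu Tv Pu Pv; have [_ _ _ _ [[_ _ f00 _] _]] := Ha.
have e0 w : tau a w = w -> psi a w = 0 -> eigensp mul a 0 w.
  by move=> Tw Pw; rewrite /eigensp mul_axis // Tw Pw; mc.
have := f00 _ _ (e0 _ Tu Pu) (e0 _ Tv Pv); rewrite /eigensp => E.
by apply: psi_unique => //; rewrite E !mulE; mc.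
Qed.

(** The product is odd for [tau a], while [psi a] is invariant under [tau a]. *)
Lemma psi_mul_skew a u v : axis a -> tau a u = u -> tau a v = - v ->
  psi a (u ** v) = 0.
Proof.
move=> Ha Tu Tv; have := psi_tau (u ** v) Ha.
rewrite tau_mul // Tu Tv mulE psiE // => /eqP.
rewrite -subr_eq0 -opprD oppr_eq0 -mulr2n -mulr_natl mulf_eq0.
by rewrite (negPf (natF0 _)) /= => /eqP.
Qed.

(** * Automorphisms of the algebra *)

Definition aut g := [/\ lin g, forall x y, g (x ** y) = g x ** g y &
  exists2 h, cancel g h & cancel h g].

Lemma aut_lin g : aut g -> lin g. Proof. by case. Qed.
Lemma aut_mul g : aut g -> forall x y, g (x ** y) = g x ** g y.
Proof. by case. Qed.

Lemma aut_comp f g : aut f -> aut g -> aut (fun v => f (g v)).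
Proof.
move=> [Lf Mf [f' fK f'K]] [Lg Mg [g' gK g'K]]; split.
- exact: lin_comp.
- by move=> x y; rewrite Mg Mf.
- by exists (fun v => g' (f' v)) => v; rewrite ?fK ?gK ?g'K ?f'K.
Qed.

Lemma aut_tau a : axis a -> aut (tau a).
Proof.
move=> Ha; split=> [|x y|]; [exact: lin_tau | exact: tau_mul |].
by exists (tau a); apply: tauK.
Qed.

Lemma aut_iter g n : aut g -> aut (iter n g).
Proof.
move=> Hg; elim: n => [|n IH]; last exact: (aut_comp Hg IH).
by split=> //; exists id.
Qed.

Lemma tau_aut g a v : aut g -> g (tau a v) = tau (g a) (g v).
Proof. by move=> Hg; rewrite !tau_def !(linE (aut_lin Hg), aut_mul Hg). Qed.

Lemma axis_aut g a : aut g -> axis a -> axis (g a).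
Proof.
move=> Hg Ha; have [a0 aa [dec uni] one [[f1 f2 f3 f4] [f5 f6]]] := Ha.
have [Lg Mg [h gK hK]] := Hg.
have Eg l u : eigensp mul (g a) l (g u) <-> eigensp mul a l u.
  rewrite /eigensp -Mg -(linE Lg); split=> [/(can_inj gK)|->] //.
have Eh l u : eigensp mul (g a) l u <-> eigensp mul a l (h u) by rewrite -Eg hK.
have hM u v : h (u ** v) = h u ** h v by rewrite -{1}[u]hK -{1}[v]hK -Mg gK.
have Lh : lin h by move=> k u v; apply: (can_inj gK); rewrite Lg !hK.
have h0 u : h u = 0 -> u = 0 by move=> E; rewrite -[u]hK E (linE Lg).
split; [| | split| | split; split].
- by apply: contra_neq a0 => ga0; rewrite -[a]gK ga0 (linE Lh).
- by rewrite -Mg aa.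
- move=> u; have [u1 [u0 [uh [E1 E0 Ehh Eu]]]] := dec (h u).
  exists (g u1), (g u0), (g uh); split; try exact/Eg.
  by rewrite -!(linE Lg) -Eu hK.
- move=> u1 u0 uh /Eh E1 /Eh E0 /Eh E E'.
  have [] := uni _ _ _ E1 E0 E; first by rewrite -!(linE Lh).1.1.2 E' (linE Lh).
  by move=> /h0-> /h0-> /h0->.
- move=> u; rewrite Eh one; split=> -[k E]; exists k.
    by rewrite -[u]hK E (linE Lg).
  by rewrite E (linE Lh) gK.
- by move=> u v /Eh E /Eh E'; rewrite Eh hM; apply: f1.
- by move=> u v /Eh E /Eh E'; apply: h0; rewrite hM; apply: f2.
- by move=> u v /Eh E /Eh E'; rewrite Eh hM; apply: f3.
- by move=> u v /Eh E /Eh E'; rewrite Eh hM; apply: f4.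
- by move=> u v /Eh E /Eh E'; rewrite Eh hM; apply: f5.
- move=> u v /Eh E /Eh E'; have [w1 [w0 [E1 E0 W]]] := f6 _ _ E E'.
  exists (g w1), (g w0); split; try exact/Eg.
  by rewrite -!(linE Lg) -W -hM hK.
Qed.

Lemma psi_aut g a v : aut g -> axis a -> psi (g a) (g v) = psi a v.
Proof.
move=> Hg Ha; apply: psi_unique; first exact: axis_aut.
by rewrite -!(aut_mul Hg) -!(linE (aut_lin Hg)) psiP.
Qed.

(** * Products of two axes and the symmetry of [psi] *)

Lemma mul_axis_pair a b : axis a ->
  a ** (a ** b) = 2%:R^-1 *: (a ** b) + (psi a b / 2%:R) *: a.
Proof.
by move=> Ha; apply: (linear_combination1 (k := 2%:R^-1) (psiP b Ha)); mc.
Qed.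

Lemma mul_pair_sq a b : axis a -> axis b -> (a ** b) ** (a ** b) =
  (psi b a / 2%:R) *: (a ** b) + (psi a b / 4%:R) *: a +
  (psi b a / 4%:R) *: b.
Proof.
move=> Ha Hb; have [_ _ _ _ [[_ _ f00 _] [f0h _]]] := Ha.
have Ea := mul_axis_pair b Ha.
have Eb := mul_axis_pair a Hb; rewrite [b ** a]mulC in Eb.
set p := a ** b in Ea Eb *; set f := psi a b in Ea *; set f' := psi b a in Eb *.
(* With [b = f a + b0 + bh] the Peirce decomposition for [a], these are [- b0 / 2] and [bh / 2]. *)
pose x0 := p - 2%:R^-1 *: (a + b) - ((f - 1) / 2%:R) *: a.
pose xh := p - f *: a.
have E0 : eigensp mul a 0 x0.
  by rewrite /eigensp /x0 !(mulE, Ea, axis_idem Ha) -/p; mc.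
have Eh : eigensp mul a (Defs.half F) xh.
  by rewrite /eigensp /xh !(mulE, Ea, axis_idem Ha) /Defs.half; mc.
have := f0h _ _ E0 Eh; have := f00 _ _ E0 E0; rewrite /eigensp => H0 Hh.
(* [x0 - xh] is free of [p], so the unknown [a ** (p ** p)] cancels on the left, and the right side
   yields [p ** p]. *)
have H : 2%:R *: (a ** (x0 ** x0)) - 2%:R *: (a ** (x0 ** xh)) =
    - (x0 ** xh) by rewrite H0 Hh /Defs.half; mc.
apply: (linear_combination1 (k := 1) H).
rewrite /x0 /xh !(mulE, Ea, Eb, axis_idem Ha, axis_idem Hb).
rewrite !(mulC _ a) !(mulC _ b) !(mulC b a).
by rewrite -!/p !(mulE, Ea, Eb, axis_idem Ha, axis_idem Hb) -!/p; mc.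
Qed.

(** Exchanging [a] and [b] in [mul_pair_sq] leaves the left side unchanged; comparing the right
    sides gives equality unless [a ** b = 0], and then both values vanish. *)
Lemma psi_sym a b : axis a -> axis b -> psi a b = psi b a.
Proof.
move=> Ha Hb; have := mul_pair_sq Hb Ha; rewrite [b ** a]mulC mul_pair_sq //.
move=> E; have {E} /eqP : ((psi a b - psi b a) / 2%:R) *: (a ** b) = 0.
  by apply: (linear_combination1 (k := -1) E); mc.
rewrite scaler_eq0 mulf_eq0 invr_eq0 (negPf (natF0 _)) orbF subr_eq0.
case/orP=> /eqP // p0.
have := psiP b Ha; have := psiP a Hb; rewrite [b ** a]mulC p0 !mulE.
rewrite !(scaler0, subr0) => /esym/eqP; rewrite scaler_eq0 (negPf (axis_neq0 Hb)).
rewrite orbF => /eqP-> /esym/eqP.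
by rewrite scaler_eq0 (negPf (axis_neq0 Ha)) orbF => /eqP->.
Qed.

(** * The axes as a spanning set *)

Hypothesis gen : forall S, subalgebra mul S -> (forall x, axis x -> S x) ->
  forall u, S u.

Lemma axes_span (P : V -> Prop) : subspace P -> (forall x, axis x -> P x) ->
  forall v, P v.
Proof.
move=> P_sub P_axis.
(* The linear span of the axes, as the intersection of all subspaces containing them; it has to be
   closed under products. *)
pose S v := forall Q, subspace Q -> (forall x, axis x -> Q x) -> Q v.
suff HS v : S v by move=> v; apply: HS.
apply: gen => [|x Hx Q _ HQ]; last exact: HQ.
split.
  split=> [Q [] // | x y Sx Sy Q HQ AQ | k x Sx Q HQ AQ].
    by case: (HQ) => _ D _; apply: D; [apply: Sx | apply: Sy].
  by case: (HQ) => _ _ Z; apply: Z; apply: Sx.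
move=> x y Sx Sy Q HQ AQ; have [Q0 QD QZ] := HQ.
have sub u : subspace (fun w => Q (u ** w)).
  split=> [|w w' | k w]; rewrite mulE //; [apply: (QD) | apply: (QZ)].
apply: (Sy (fun w => Q (x ** w))) => // b Hb; rewrite mulC.
apply: (Sx (fun w => Q (b ** w))) => // a Ha.
(* [a ** b] lies in the span of [a], [b] and [tau a b]. *)
have -> : b ** a = psi a b *: a + 4%:R^-1 *: (b + (-1) *: tau a b).
  by rewrite scaleN1r -mul_axis // mulC.
apply: (QD); apply: (QZ); first exact: AQ.
apply: QD; first exact: AQ.
by apply: QZ; apply: AQ; apply: axis_aut => //; apply: aut_tau.
Qed.

(** [psi] is linear only in its second argument. For an axis [v], symmetry moves the relation there;
    the axes span the rest. *)
Lemma psi_linear_axis x y z w k v : axis x -> axis y -> axis z -> axis w ->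
  x - y = k *: (z - w) -> psi x v - psi y v = k * (psi z v - psi w v).
Proof.
move=> Hx Hy Hz Hw E; pattern v; apply: axes_span; first split.
- by rewrite !psiE //; ring.
- move=> u u' H H'; rewrite !psiE //.
  by transitivity ((psi x u - psi y u) + (psi x u' - psi y u'));
    [ring | rewrite H H'; ring].
- move=> l u H; rewrite !psiE //.
  by transitivity (l * (psi x u - psi y u)); [ring | rewrite H; ring].
- move=> u Hu; rewrite !(psi_sym _ Hu) //.
  by move/(congr1 (psi u)): E; rewrite !psiE.
Qed.

(** * Pairs of axes with unipotent [rho] *)

Lemma infinite_axes_seq (f : nat -> V) : (forall n, axis (f n)) -> injective f ->
  infinitely_many_axes mul.
Proof.
move=> Hf If [s Hs]; have := @uniq_leq_size _ (map f (iota 0 (size s).+1)) s.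
rewrite map_inj_uniq ?iota_uniq // size_map size_iota ltnn => H.
suff : false by [].
by apply: H => // _ /mapP[n _ ->]; apply: Hs.
Qed.

Lemma natF_inj : injective (fun n => n%:R : F).
Proof.
move=> m n; wlog le_mn : m n / (m <= n)%N.
  by case/orP: (leq_total m n) => le H /eqP; [|rewrite eq_sym] => /eqP/H->.
move=> E; apply/eqP; rewrite eqn_leq le_mn /= -subn_eq0.
have /pcharf0P H := charF0.
by rewrite -H natrB // E subrr.
Qed.

(** Both axes act on [a ** b] as 1/2, so both involutions negate it and [rho] fixes it: the orbit of
    [a] is an arithmetic progression with difference [- 4 (a ** b)]. *)
Lemma infinite_axes_psi0 a b : axis a -> axis b -> psi a b = 0 -> a ** b != 0 ->
  infinitely_many_axes mul.
Proof.
move=> Ha Hb f0 p0; have f0' : psi b a = 0 by rewrite psi_sym.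
pose rho v := tau b (tau a v).
have Hr : aut rho by apply: aut_comp; apply: aut_tau.
apply: (@infinite_axes_seq (fun n => iter n rho a)) => [n | m n].
  by apply: axis_aut => //; apply: aut_iter.
have rp : rho (a ** b) = a ** b.
  have Ea : a ** (a ** b) = 2%:R^-1 *: (a ** b).
    by rewrite mul_axis_pair // f0; mc.
  have Eb : b ** (a ** b) = 2%:R^-1 *: (a ** b).
    by rewrite (mulC a) mul_axis_pair // f0'; mc.
  rewrite /rho [tau a _]tau_def !(Ea, mulE).
  by rewrite !(linE (lin_tau b)) !tau_def !(Eb, mulE); mc.
have E k : iter k rho a = a - (4%:R * k%:R) *: (a ** b).
  elim: k => [|k IH]; first by rewrite /= mulr0 scale0r subr0.
  rewrite iterS IH !(linE (aut_lin Hr)) rp {1}/rho tau_self // tau_axis // f0'.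
  by rewrite (mulC b) -addn1 natrD; mc.
rewrite !E => /addrI/oppr_inj/eqP.
rewrite -subr_eq0 -scalerBl scaler_eq0 (negPf p0) orbF -mulrBr mulf_eq0.
by rewrite (negPf (natF0 _)) subr_eq0 => /eqP; apply: natF_inj.
Qed.

Lemma infinite_axes_psi1 a b : axis a -> axis b -> psi a b = 1 -> a != b ->
  infinitely_many_axes mul.
Proof.
move=> Ha Hb f1 ab; have f1' : psi b a = 1 by rewrite psi_sym.
pose rho v := tau b (tau a v).
have Hr : aut rho by apply: aut_comp; apply: aut_tau.
have Lr := linE (aut_lin Hr).
apply: (@infinite_axes_seq (fun n => iter n rho a)) => [n | m n].
  by apply: axis_aut => //; apply: aut_iter.
(* Both axes annihilate [s], so [rho] fixes it. On the span of [a], [b - a], [s] the map [rho] is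
   unipotent, which makes the iterates below quadratic in [k]. *)
have [s sE] : exists s, s = a ** b - 2%:R^-1 *: (a + b) by eexists.
have as0 : a ** s = 0.
  by rewrite sE !mulE mul_axis_pair // f1 axis_idem //; mc.
have bs0 : b ** s = 0.
  by rewrite sE !mulE (mulC a b) mul_axis_pair // f1' axis_idem //; mc.
have rs : rho s = s.
  by rewrite /rho [tau a s]tau_def as0 mulE !(scaler0, subr0, addr0) !tau_def bs0 mulE; mc.
have ra : rho a = a + 2%:R *: (b - a) - 4%:R *: s.
  by rewrite /rho tau_self // tau_axis // f1' sE (mulC b); mc.
have rb : rho b = a + 3%:R *: (b - a) - 12%:R *: s.
  have -> : rho b = tau b (2%:R *: a - b - 4%:R *: s).
    by rewrite /rho; congr tau; rewrite tau_axis // f1 sE; mc.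
  have tbs : tau b s = s by rewrite !tau_def bs0 mulE; mc.
  rewrite !(linE (lin_tau b)) tbs tau_self // [tau b a]tau_axis // f1'.
  by rewrite sE (mulC b a); mc.
have E k : iter k rho a = a + (2%:R * k%:R) *: (b - a)
    - (4%:R * k%:R * (2%:R * k%:R - 1)) *: s.
  elim: k => [|k IH]; first by rewrite /=; mc.
  by rewrite iterS IH !Lr rs ra rb -addn1 natrD; mc.
wlog lt_mn : m n / (m < n)%N.
  by case: (ltngtP m n) => [lt | lt | //] H /=; [apply: H | move/esym/H=> ->].
have mn0 : n%:R - m%:R != 0 :> F 
  by rewrite subr_eq0; apply: contraTneq lt_mn => /natF_inj->; rewrite ltnn.
rewrite !E => D.
have {}D : b - a = (2%:R * (2%:R * (n%:R + m%:R)) - 2%:R) *: s.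
  apply: (linear_combination1 (k := - (2%:R * (n%:R - m%:R))^-1) D).
  by mc; field; rewrite mn0 natF0.
(* Multiplying by [a], which annihilates [s], gives [a ** b = a]. The two relations between [s] and
   [b - a] together force [2 (n + m) s = 0]. *)
have : s = (-2%:R^-1) *: (b - a).
  have := congr1 (mul a) D; rewrite !mulE as0 scaler0 axis_idem // => /eqP.
  by rewrite subr_eq0 => /eqP E'; rewrite sE E'; mc.
rewrite {1}D scalerA => Es; case/eqP: ab.
have : s = 0.
  apply: (@scaler_cancel _ _ (2%:R * (n + m)%:R)).
    by rewrite mulf_neq0 ?natF0 //; case: (n) lt_mn => // k _; rewrite addSn natF0.
  by apply: (linear_combination1 (k := 1) Es); rewrite natrD; mc.
by move=> s0; move/eqP: D; rewrite s0 scaler0 subr_eq0 => /eqP.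
Qed.

(** * The torus of a generic pair of axes *)

Section Circle.
Variables (a b e u0 u1 : V) (c : F).
Hypotheses (Ha : axis a) (Hb : axis b).
Hypotheses (aE : a = 2%:R^-1 *: e + 2%:R^-1 *: u0)
  (bE : b = 2%:R^-1 *: e + 2%:R^-1 *: u1).
Hypotheses (ee : e ** e = e) (eu0 : e ** u0 = u0) (eu1 : e ** u1 = u1)
  (u00 : u0 ** u0 = e) (u11 : u1 ** u1 = e) (u01 : u0 ** u1 = c *: e).
Hypotheses (c1 : c - 1 != 0) (cN1 : 1 + c != 0) (cNh : 1 + 2%:R * c != 0).

(** * Computations in the span of [e], [u0], [u1] *)

Let c1' : 1 - c != 0. Proof. by rewrite -opprB oppr_eq0. Qed.
Let c2' : 1 - c * c != 0.
Proof. by rewrite (_ : _ - _ = (1 - c) * (1 + c)) ?mulf_neq0 //; ring. Qed.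
Let u0e : u0 ** e = u0. Proof. by rewrite mulC. Qed.
Let u1e : u1 ** e = u1. Proof. by rewrite mulC. Qed.
Let u10 : u1 ** u0 = c *: e. Proof. by rewrite mulC. Qed.
Local Notation uE := (ee, eu0, eu1, u00, u11, u01, u0e, u1e, u10).

Local Ltac nz := rewrite ?natF0 ?c1 ?cN1 ?cNh ?c1' ?c2' /=.
Local Ltac ffc := try by [field; nz | ring].
Local Ltac mcc := mcoefs F; ffc.

Let psi_ae : psi a e = 1.
Proof. by apply: psi_unique => //; rewrite aE !(mulE, uE); mcc. Qed.
Let psi_au0 : psi a u0 = 1.
Proof. by apply: psi_unique => //; rewrite aE !(mulE, uE); mcc. Qed.
Let psi_au1 : psi a u1 = c.
Proof. by apply: psi_unique => //; rewrite aE !(mulE, uE); mcc. Qed.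
Let psi_be : psi b e = 1.
Proof. by apply: psi_unique => //; rewrite bE !(mulE, uE); mcc. Qed.
Let psi_bu0 : psi b u0 = c.
Proof. by apply: psi_unique => //; rewrite bE !(mulE, uE); mcc. Qed.
Let psi_bu1 : psi b u1 = 1.
Proof. by apply: psi_unique => //; rewrite bE !(mulE, uE); mcc. Qed.
Local Notation psiuE := (psi_ae, psi_au0, psi_au1, psi_be, psi_bu0, psi_bu1).

Let tau_ae : tau a e = e.
Proof. by rewrite !tau_def aE !(mulE, uE); mcc. Qed.
Let tau_au0 : tau a u0 = u0.
Proof. by rewrite !tau_def aE !(mulE, uE); mcc. Qed.
Let tau_au1 : tau a u1 = (2%:R * c) *: u0 - u1.
Proof. by rewrite !tau_def aE !(mulE, uE); mcc. Qed.
Let tau_be : tau b e = e.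
Proof. by rewrite !tau_def bE !(mulE, uE); mcc. Qed.
Let tau_bu1 : tau b u1 = u1.
Proof. by rewrite !tau_def bE !(mulE, uE); mcc. Qed.
Let tau_bu0 : tau b u0 = (2%:R * c) *: u1 - u0.
Proof. by rewrite !tau_def bE !(mulE, uE); mcc. Qed.
Local Notation ta := (linE (lin_tau a)).
Local Notation tb := (linE (lin_tau b)).
Local Notation tauE := (tau_ae, tau_au0, tau_au1, tau_be, tau_bu0, tau_bu1).

Definition rot v := tau b (tau a v).
Definition rotV v := tau a (tau b v).
Let aut_rot : aut rot. Proof. by apply: aut_comp; apply: aut_tau. Qed.
Let rM x y : rot (x ** y) = rot x ** rot y. Proof. exact: aut_mul aut_rot x y. Qed.
Let r := linE (aut_lin aut_rot).
Let lin_rotV : lin rotV. Proof. by apply: lin_comp; apply: lin_tau. Qed.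
Let ri := linE lin_rotV.
Let rotK v : rotV (rot v) = v. Proof. by rewrite /rot /rotV !tauK. Qed.
Let rotVK v : rot (rotV v) = v. Proof. by rewrite /rot /rotV !tauK. Qed.
Let rot_e : rot e = e. Proof. by rewrite /rot !tauE. Qed.
Let rotV_e : rotV e = e. Proof. by rewrite /rotV !tauE. Qed.
Let rot_u0 : rot u0 = (2%:R * c) *: u1 - u0. Proof. by rewrite /rot !tauE. Qed.
Let rot_u1 : rot u1 = (4%:R * c * c - 1) *: u1 - (2%:R * c) *: u0.
Proof. by rewrite /rot !(tauE, ta, tb); mcc. Qed.
Let rotV_u1 : rotV u1 = (2%:R * c) *: u0 - u1. Proof. by rewrite /rotV !tauE. Qed.
Let rotV_u0 : rotV u0 = (4%:R * c * c - 1) *: u0 - (2%:R * c) *: u1.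
Proof. by rewrite /rotV !(tauE, ta, tb); mcc. Qed.
Local Notation ruE := (rot_e, rotV_e, rot_u0, rot_u1, rotV_u0, rotV_u1).
Let tau_a_rot v : tau a (rot v) = rotV (tau a v). Proof. by []. Qed.
Let tau_b_rot v : tau b v = rot (tau a v). Proof. by rewrite /rot tauK. Qed.

Let tau_ba : tau b a = 2%:R^-1 *: e + c *: u1 - 2%:R^-1 *: u0.
Proof. by rewrite aE !(tb, tauE); mcc. Qed.
Let tau_ab : tau a b = 2%:R^-1 *: e + c *: u0 - 2%:R^-1 *: u1.
Proof. by rewrite bE !(ta, tauE); mcc. Qed.
(** The axes [tau a b], [a], [b], [tau b a] lie on a circle at angles -theta, 0, theta, 2 theta, so
    these two chords are parallel. *)
Let four_axes : tau b a - tau a b = (1 + 2%:R * c) *: (b - a).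
Proof. by rewrite tau_ba tau_ab bE aE; mcc. Qed.

(** By invariance [psi a (tau b v) = psi (tau b a) v], and likewise for [tau a b]; this is
    [four_axes] read in the first argument of [psi]. *)
Let psi_rel v : psi a (tau b v) - psi b (tau a v) =
  (1 + 2%:R * c) * (psi b v - psi a v).
Proof.
have Aa := aut_tau Ha; have Ab := aut_tau Hb.
rewrite -[psi a (tau b v)](psi_aut _ Ab) // -[psi b (tau a v)](psi_aut _ Aa) //.
rewrite !tauK //; apply: psi_linear_axis four_axes => //; exact: axis_aut.
Qed.

(* The orthogonal complement of the span of [e], [u0], [u1]. *)
Definition perp v := [/\ psi a v = 0, psi b v = 0 & psi a (tau b v) = 0].

Let perp_m v : perp v -> psi b (tau a v) = 0.
Proof.
case=> A B C; have := psi_rel v; rewrite A B C => /eqP.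
by rewrite subrr mulr0 sub0r oppr_eq0 => /eqP.
Qed.

Let perp_lin k x y : perp x -> perp y -> perp (k *: x + y).
Proof.
case=> A B C [A' B' C']; rewrite /perp lin_tau !psi_linear //.
by rewrite A B C A' B' C' !mulr0 !addr0.
Qed.

Let perp0 : perp 0. Proof. by rewrite /perp !(tb, psiE). Qed.
Let perpD x y : perp x -> perp y -> perp (x + y).
Proof. by move=> *; rewrite -[x]scale1r; apply: perp_lin. Qed.
Let perpZ k x : perp x -> perp (k *: x).
Proof. by move=> *; rewrite -[_ *: _]addr0; apply: perp_lin => //; apply: perp0. Qed.
Let perpN x : perp x -> perp (- x).
Proof. by rewrite -scaleN1r; apply: perpZ. Qed.

Let perp_tau_a v : perp v -> perp (tau a v).
Proof.
move=> Kv; have m := perp_m Kv; have [A B C] := Kv.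
split=> //; first by rewrite psi_tau.
have := psi_rel (tau a v); rewrite tauK // psi_tau // A B m => /eqP.
by rewrite !subr0 mulr0 => /eqP.
Qed.

Let perp_tau_b v : perp v -> perp (tau b v).
Proof. by move=> [A B C]; rewrite /perp tauK // psi_tau. Qed.

Let perp_rot v : perp v -> perp (rot v).
Proof. by move=> Kv; apply/perp_tau_b/perp_tau_a. Qed.
Let perp_rotV v : perp v -> perp (rotV v).
Proof. by move=> Kv; apply/perp_tau_a/perp_tau_b. Qed.

Let mul_perp_a v : perp v -> a ** v = 4%:R^-1 *: (v - tau a v).
Proof. by case=> A _ _; rewrite mul_axis // A; mcc. Qed.
Let mul_perp_b v : perp v -> b ** v = 4%:R^-1 *: (v - tau b v).
Proof. by case=> _ B _; rewrite mul_axis // B; mcc. Qed.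
Let mul_perp_2 v : perp v ->
  tau b a ** v = 4%:R^-1 *: (v - tau b (tau a (tau b v))).
Proof.
move=> Kv; rewrite -{1}[v](tauK Hb) -tau_mul // mul_perp_a; last exact: perp_tau_b.
by rewrite !tb tauK.
Qed.
Let mul_perp_m v : perp v ->
  tau a b ** v = 4%:R^-1 *: (v - tau a (tau b (tau a v))).
Proof.
move=> Kv; rewrite -{1}[v](tauK Ha) -tau_mul // mul_perp_b; last exact: perp_tau_a.
by rewrite !ta tauK.
Qed.

(** Each of the four axes acts on [perp] as a quarter of 1 minus its involution; multiply
    [four_axes] by [tau a v]. The result says [(rot - 1) (rot^2 - 2 c rot + 1) = 0] on [perp], where
    only the weights 0, 1, -1 therefore occur. *)
Let rot_cubic v : perp v ->
  rot (rot v) = (1 + 2%:R * c) *: (rot v - v) + rotV v.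
Proof.
move=> Kv; have Kt := perp_tau_a Kv.
have := congr1 (mul^~ (tau a v)) four_axes; rewrite /= !mulE.
rewrite mul_perp_2 // mul_perp_m // mul_perp_a // mul_perp_b // tauK //.
rewrite -!/(rot _) -/(rotV _) => E'.
by apply: (linear_combination1 (k := -4%:R) E'); rewrite /rot; mcc.
Qed.

(* Weight 0, and the sum of the weights 1 and -1: the grading itself need not be
   defined over [F], as the eigenvalues of [rot] need not lie in [F]. *)
Definition wt0 v := rot v = v.
Definition wt1 v := perp v /\ rot v + rotV v = (2%:R * c) *: v.

Let wt1_rotV m : wt1 m -> rotV m = (2%:R * c) *: m - rot m.
Proof. by case=> _ <-; mcc. Qed.
Let wt1_rot2 m : wt1 m -> rot (rot m) = (2%:R * c) *: rot m - m.
Proof. by case=> _ /(congr1 rot); rewrite !r rotVK => <-; mcc. Qed.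
Let wt1_rot m : wt1 m -> wt1 (rot m).
Proof.
move=> Hm; split; first by case: Hm => /perp_rot.
by rewrite wt1_rot2 // rotK; mcc.
Qed.
Let wt1_tau_a m : wt1 m -> wt1 (tau a m).
Proof.
move=> Hm; split; first by case: Hm => /perp_tau_a.
case: Hm => _ /(congr1 (tau a)); rewrite !ta tau_a_rot => <-.
by rewrite addrC; congr (_ + _); rewrite /rotV /rot !tauK.
Qed.
Let wt1_lin k x y : wt1 x -> wt1 y -> wt1 (k *: x + y).
Proof.
move=> [Kx Ex] [Ky Ey]; split; first exact: perp_lin.
rewrite !(r, ri).
have -> : k *: rot x + rot y + (k *: rotV x + rotV y) =
  k *: (rot x + rotV x) + (rot y + rotV y) by mcc.
by rewrite Ex Ey; mcc.
Qed.
Let wt10 : wt1 0. Proof. by split; [apply: perp0 | rewrite !(r, ri); mcc]. Qed.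
Let wt1D x y : wt1 x -> wt1 y -> wt1 (x + y).
Proof. by move=> *; rewrite -[x]scale1r; apply: wt1_lin. Qed.
Let wt1Z k x : wt1 x -> wt1 (k *: x).
Proof. by move=> *; rewrite -[_ *: _]addr0; apply: wt1_lin => //; apply: wt10. Qed.

(* The coordinates of the projection to the span of [e], [u0], [u1]. *)
Definition cs v := (psi a v - psi a (tau b v)) / (2%:R * (1 - c * c)).
Definition ct v := cs v + (psi b v - psi a v) / (1 - c).
Definition cg v := psi a v - cs v - c * ct v.

Let csE : ((cs 0 = 0)%R * (forall x y, cs (x + y) = cs x + cs y)%R *
   (forall x, cs (- x) = - cs x)%R * (forall k x, cs (k *: x) = k * cs x)%R)%type.
Proof. by do 3?[split]; move=> *; rewrite /cs !(tb, psiE) //; ring. Qed.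
Let ctE : ((ct 0 = 0)%R * (forall x y, ct (x + y) = ct x + ct y)%R *
   (forall x, ct (- x) = - ct x)%R * (forall k x, ct (k *: x) = k * ct x)%R)%type.
Proof. by do 3?[split]; move=> *; rewrite /ct !csE !(tb, psiE) //; ring. Qed.
Let cgE : ((cg 0 = 0)%R * (forall x y, cg (x + y) = cg x + cg y)%R *
   (forall x, cg (- x) = - cg x)%R * (forall k x, cg (k *: x) = k * cg x)%R)%type.
Proof. by do 3?[split]; move=> *; rewrite /cg !(csE, ctE) !(tb, psiE) //; ring. Qed.

Let psi2_u0 : psi a (tau b u0) = 2%:R * c * c - 1.
Proof. by rewrite tauE !(psiE, psiuE) //; ring. Qed.
Let psi2_u1 : psi a (tau b u1) = c.
Proof. by rewrite tauE !psiuE. Qed.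
Let cs_u0 : cs u0 = 1. Proof. by rewrite /cs psi2_u0 !psiuE; ffc. Qed.
Let cs_u1 : cs u1 = 0. Proof. by rewrite /cs psi2_u1 !psiuE; ffc. Qed.
Let cs_e : cs e = 0. Proof. by rewrite /cs tauE subrr mul0r. Qed.
Let ct_u0 : ct u0 = 0. Proof. by rewrite /ct cs_u0 !psiuE; ffc. Qed.
Let ct_u1 : ct u1 = 1. Proof. by rewrite /ct cs_u1 !psiuE; ffc. Qed.
Let ct_e : ct e = 0. Proof. by rewrite /ct cs_e !psiuE; ffc. Qed.
Let cg_u0 : cg u0 = 0. Proof. by rewrite /cg cs_u0 ct_u0 !psiuE; ffc. Qed.
Let cg_u1 : cg u1 = 0. Proof. by rewrite /cg cs_u1 ct_u1 !psiuE; ffc. Qed.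
Let cs_perp v : perp v -> cs v = 0.
Proof. by case=> A B C; rewrite /cs A C; ffc. Qed.
Let ct_perp v : perp v -> ct v = 0.
Proof. by move=> Kv; case: (Kv) => A B C; rewrite /ct cs_perp // A B; ffc. Qed.
Let cg_perp v : perp v -> cg v = 0.
Proof. by move=> Kv; case: (Kv) => A B C; rewrite /cg cs_perp // ct_perp // A; ffc. Qed.

(** * Decomposition into weights *)

Let wt0_rotV x : wt0 x -> rotV x = x.
Proof. by move=> Hx; rewrite -{1}Hx rotK. Qed.

(** A vector fixed by [rot] has the same image under [tau a] and [tau b], so [psi_rel] becomes
    [2 (1 + c) (psi b x - psi a x) = 0]. *)
Let wt0_psi x : wt0 x -> psi b x = psi a x /\ psi a (tau b x) = psi a x.
Proof.
move=> Hx; have Ex : tau b x = tau a x by rewrite -{1}Hx /rot tauK.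
have E := psi_rel x; rewrite Ex psi_tau // -Ex psi_tau // in E.
split; last by rewrite Ex psi_tau.
have : 2%:R * (1 + c) * (psi b x - psi a x) =
  (1 + 2%:R * c) * (psi b x - psi a x) - (psi a x - psi b x) by ring.
rewrite -E subrr => /eqP; rewrite !mulf_eq0 (negPf (natF0 _)) (negPf cN1) subr_eq0.
by move/eqP.
Qed.

Let cs_wt0 x : wt0 x -> cs x = 0.
Proof. by case/wt0_psi => _ E; rewrite /cs E subrr mul0r. Qed.
Let ct_wt0 x : wt0 x -> ct x = 0.
Proof. by move=> Hx; case/wt0_psi: (Hx) => E _; rewrite /ct cs_wt0 // E; ring. Qed.
Definition cperp v := v - cg v *: e - cs v *: u0 - ct v *: u1.
(** On [perp], the projection to weight 0: [rot + rotV - 2 c] kills the weights 1 and -1 and is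
    [2 (1 - c)] on weight 0. *)
Definition cfix k := (2%:R * (1 - c))^-1 *: (rot k - (2%:R * c) *: k + rotV k).
Definition comp0 v := locked (cg v *: e + cfix (cperp v)).
Definition comp1 v := locked (cperp v - cfix (cperp v)).

Let perp_cperp v : perp (cperp v).
Proof.
rewrite /perp /cperp !(tb, psiE) // !psi2_u0 !psi2_u1 tau_be !psiuE.
split; rewrite /cg /ct /cs; ffc.
Qed.

Let lin_cperp : lin cperp.
Proof. by move=> k x y; rewrite /cperp !(csE, ctE, cgE); mcc. Qed.
Let lin_cfix : lin cfix.
Proof. by move=> k x y; rewrite /cfix !(r, ri); mcc. Qed.
Let lin_comp0 : lin comp0.
Proof. by move=> k x y; rewrite /comp0 -!lock lin_cperp lin_cfix !cgE; mcc. Qed.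
Let lin_comp1 : lin comp1.
Proof. by move=> k x y; rewrite /comp1 -!lock lin_cperp lin_cfix; mcc. Qed.

Let comp_sum v : v = comp0 v + comp1 v + cs v *: u0 + ct v *: u1.
Proof. by rewrite /comp0 /comp1 -!lock {1}/cperp /cperp; mcc. Qed.

Let wt0_comp0 v : wt0 (comp0 v).
Proof.
have := rot_cubic (perp_cperp v).
rewrite /wt0 /comp0 -lock /cfix; move: (cperp v) => k E.
by rewrite !(r, rot_e) rotVK E; mcc.
Qed.

Let wt1_comp1 v : wt1 (comp1 v).
Proof.
rewrite /comp1 -lock; move: (cperp v) (perp_cperp v) => k Kk.
have [f fE] : exists f, f = cfix k by eexists.
have Kf : perp f.
  rewrite fE; apply: perpZ; apply: perpD; last exact: perp_rotV.
  by apply: perpD; [apply: perp_rot | apply: perpN; apply: perpZ].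
have Ef : rot f = f by rewrite fE /cfix !r rotVK rot_cubic //; mcc.
rewrite -fE; split; first by apply: perpD => //; apply: perpN.
by rewrite !(r, ri) (wt0_rotV Ef) Ef fE /cfix; mcc.
Qed.

Let decomp v : exists x m s t,
  [/\ wt0 x, wt1 m & v = x + m + s *: u0 + t *: u1].
Proof.
exists (comp0 v), (comp1 v), (cs v), (ct v); split=> //; exact: comp_sum.
Qed.

Let comp_wt0 x : wt0 x -> comp0 x = x /\ comp1 x = 0.
Proof.
move=> Hx; rewrite /comp0 /comp1 -!lock /cperp cs_wt0 // ct_wt0 // /cfix.
by rewrite !(r, ri, ruE) wt0_rotV // Hx; split; mcc.
Qed.
Let comp_wt1 m : wt1 m -> comp0 m = 0 /\ comp1 m = m.
Proof.
case=> Km Hm; rewrite /comp0 /comp1 -!lock /cperp cs_perp // ct_perp // cg_perp //.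
have -> : m - 0 *: e - 0 *: u0 - 0 *: u1 = m by mcc.
have -> : cfix m = (2%:R * (1 - c))^-1 *: (rot m + rotV m - (2%:R * c) *: m).
  by rewrite /cfix; mcc.
by rewrite Hm; split; mcc.
Qed.
Let comp_u0 : comp0 u0 = 0 /\ comp1 u0 = 0.
Proof.
rewrite /comp0 /comp1 -!lock /cperp cs_u0 ct_u0 cg_u0.
have -> : u0 - 0 *: e - 1 *: u0 - 0 *: u1 = 0 by mcc.
by rewrite (linE lin_cfix); split; mcc.
Qed.
Let comp_u1 : comp0 u1 = 0 /\ comp1 u1 = 0.
Proof.
rewrite /comp0 /comp1 -!lock /cperp cs_u1 ct_u1 cg_u1.
have -> : u1 - 0 *: e - 0 *: u0 - 1 *: u1 = 0 by mcc.
by rewrite (linE lin_cfix); split; mcc.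
Qed.

Let cs_sum x m s t : wt0 x -> wt1 m -> cs (x + m + s *: u0 + t *: u1) = s.
Proof.
by move=> Hx [Km _]; rewrite !csE cs_wt0 // cs_perp // cs_u0 cs_u1; ring.
Qed.
Let ct_sum x m s t : wt0 x -> wt1 m -> ct (x + m + s *: u0 + t *: u1) = t.
Proof.
by move=> Hx [Km _]; rewrite !ctE ct_wt0 // ct_perp // ct_u0 ct_u1; ring.
Qed.
Let comp0_sum x m s t : wt0 x -> wt1 m -> comp0 (x + m + s *: u0 + t *: u1) = x.
Proof.
move=> Hx Hm; rewrite !(linE lin_comp0) (comp_wt0 Hx).1 (comp_wt1 Hm).1.
by rewrite comp_u0.1 comp_u1.1; mcc.
Qed.
Let comp1_sum x m s t : wt0 x -> wt1 m -> comp1 (x + m + s *: u0 + t *: u1) = m.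
Proof.
move=> Hx Hm; rewrite !(linE lin_comp1) (comp_wt0 Hx).2 (comp_wt1 Hm).2.
by rewrite comp_u0.2 comp_u1.2; mcc.
Qed.

Let rot_sum x m s t : wt0 x -> rot (x + m + s *: u0 + t *: u1) =
  x + rot m + (- s - 2%:R * c * t) *: u0 +
  (2%:R * c * s + (4%:R * c * c - 1) * t) *: u1.
Proof. by move=> Hx; rewrite !(r, ruE) Hx; mcc. Qed.

Let cs_rot v : cs (rot v) = - cs v - 2%:R * c * ct v.
Proof.
have [x [m [s [t [Hx Hm ->]]]]] := decomp v.
by rewrite rot_sum // !cs_sum ?ct_sum //; apply: wt1_rot.
Qed.
Let ct_rot v : ct (rot v) = 2%:R * c * cs v + (4%:R * c * c - 1) * ct v.
Proof.
have [x [m [s [t [Hx Hm ->]]]]] := decomp v.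
by rewrite rot_sum // !ct_sum ?cs_sum //; apply: wt1_rot.
Qed.
Let comp0_rot v : comp0 (rot v) = comp0 v.
Proof.
have [x [m [s [t [Hx Hm ->]]]]] := decomp v.
by rewrite rot_sum // !comp0_sum //; apply: wt1_rot.
Qed.
Let comp1_rot v : comp1 (rot v) = rot (comp1 v).
Proof.
have [x [m [s [t [Hx Hm ->]]]]] := decomp v.
by rewrite rot_sum // !comp1_sum //; apply: wt1_rot.
Qed.

(* The perpendicularity in [wt1] is automatic; this uses [1 + 2 c != 0]. *)
Let wt1_intro v : rot (rot v) = (2%:R * c) *: rot v - v -> wt1 v.
Proof.
move=> E.
have Es : cs v = 0 /\ ct v = 0.
  have := congr1 cs E; have := congr1 ct E.
  rewrite !csE !ctE !(cs_rot, ct_rot); move: (cs v) (ct v) => s t Et Es.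
  (* On the plane [rot^2 = (4 c^2 - 2) rot - 1]. Subtracting [E] leaves the factor
     [4 c^2 - 2 - 2 c = 2 (1 + 2 c) (c - 1)] on the coordinates of [rot v]. *)
  have nz z : 2%:R * (1 + 2%:R * c) * (c - 1) * z = 0 -> z = 0.
    by move/eqP; rewrite !mulf_eq0 (negPf (natF0 _)) (negPf cNh) (negPf c1) => /eqP.
  have s1 : - s - 2%:R * c * t = 0.
    by apply: nz; move/eqP: Es; rewrite -subr_eq0 => /eqP H; rewrite -[RHS]H; ring.
  have t1 : 2%:R * c * s + (4%:R * c * c - 1) * t = 0.
    by apply: nz; move/eqP: Et; rewrite -subr_eq0 => /eqP H; rewrite -[RHS]H; ring.
  have t0 : t = 0.
    transitivity (- (2%:R * c * s + (4%:R * c * c - 1) * t)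
      - 2%:R * c * (- s - 2%:R * c * t)); first by ring.
    by rewrite s1 t1; ring.
  by split=> //; move: s1; rewrite t0 mulr0 subr0 => /eqP; rewrite oppr_eq0 => /eqP.
have E0 : comp0 v = 0.
  have := congr1 comp0 E; rewrite !(linE lin_comp0) !comp0_rot => E'.
  apply: (@scaler_cancel _ _ (2%:R * (1 - c))); first by rewrite mulf_neq0 ?natF0.
  by apply: (linear_combination1 (k := 1) E'); mcc.
rewrite [v]comp_sum E0 Es.1 Es.2 !scale0r !addr0 add0r; exact: wt1_comp1.
Qed.

(** The part [k] of [x] in [perp] has the same product with [a], [b] and [tau b a], so [u0] and [u1]
    annihilate it. *)
Let wt0_mul x : wt0 x -> x ** u0 = psi a x *: u0 /\ x ** u1 = psi a x *: u1.
Proof.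
move=> Hx; have [Px P2x] := wt0_psi Hx.
have [k kE] : exists k, k = x - psi a x *: e by eexists.
have Kk : perp k.
  by rewrite kE /perp !(tb, tau_be) !psiE // !psiuE Px P2x; split; ring.
have Rk : rot k = k by rewrite kE !(r, rot_e) Hx.
have Ek : tau b k = tau a k by rewrite -{1}Rk /rot tauK.
have := mul_perp_2 Kk; rewrite -/(rotV k) (wt0_rotV Rk) -mul_perp_b //.
have := mul_perp_b Kk; rewrite Ek -mul_perp_a //.
move=> E1 E2; rewrite ?tau_ba bE aE !mulE in E1 E2.
have u1k : u1 ** k = 0.
  apply: (scaler_cancel c1).
  by apply: (linear_combination2 (k := 1) (k' := -1) E2 E1); mcc.
have u0k : u0 ** k = 0.
  by apply: (linear_combination1 (k := -2%:R) E1); rewrite u1k; mcc.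
have xE : x = k + psi a x *: e by rewrite kE; mcc.
by split; rewrite {1}xE !mulE uE (mulC k) ?u0k ?u1k add0r.
Qed.

Let wt1_mul m : wt1 m -> [/\ e ** m = 2%:R^-1 *: m,
  u0 ** m = (- 2%:R^-1) *: tau a m & u1 ** m = (- 2%:R^-1) *: rot (tau a m)].
Proof.
move=> Hm; have Km := Hm.1; have Hw := wt1_tau_a Hm.
have := mul_perp_2 Km; rewrite [tau b m]tau_b_rot -/(rot _) wt1_rot2 //.
have := mul_perp_b Km; rewrite tau_b_rot.
have := mul_perp_a Km.
rewrite tau_ba bE aE !mulE; move: (tau a m) Hw => w Hw E1 E2 E3.
have em : e ** m = 2%:R^-1 *: m.
  (* The products of [m] with [a], [b] and [tau b a] are known, and
     [a + tau b a - 2 c b = (1 - c) e]. *)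
  have E : (1 - c)^-1 *: ((2%:R^-1 *: (e ** m) + 2%:R^-1 *: (u0 ** m)) +
     (2%:R^-1 *: (e ** m) + c *: (u1 ** m) - 2%:R^-1 *: (u0 ** m)) -
     (2%:R * c) *: (2%:R^-1 *: (e ** m) + 2%:R^-1 *: (u1 ** m))) = e ** m by mcc.
  by rewrite -E E1 E2 E3; mcc.
split=> //.
  by apply: (linear_combination1 (k := 2%:R) E1); rewrite em; mcc.
by apply: (linear_combination1 (k := 2%:R) E2); rewrite em; mcc.
Qed.

(* If [k] and [l] have the same weight 1 or -1, then [sym k l] is to be
   [2 R (k ** l)], where [R] is the half rotation [u0 |-> u1] of the plane. *)
Let sym k l := rot k ** l + k ** rot l.

Let rot_sym k l : wt1 k -> wt1 l -> rot (sym k l) =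
  (4%:R * c) *: rot (k ** l) - sym k l.
Proof. by move=> Hk Hl; rewrite /sym !r !rM !wt1_rot2 // !mulE; mcc. Qed.

Let rot2_mul k l : wt1 k -> wt1 l -> rot (rot (k ** l)) =
  (4%:R * c * c) *: rot (k ** l) - (2%:R * c) *: sym k l + k ** l.
Proof. by move=> Hk Hl; rewrite /sym !rM !wt1_rot2 // !mulE; mcc. Qed.

(** On [k ** l] the map [rot] satisfies the cubic with roots 1, [z^2], [z^-2]; on [wt1] it satisfies
    the quadratic with roots [z], [z^-1]. They are coprime as [c] is neither 1 nor -1/2. *)
Let comp1_mul k l : wt1 k -> wt1 l -> comp1 (k ** l) = 0 /\ comp1 (sym k l) = 0.
Proof.
move=> Hk Hl.
have := rot2_mul Hk Hl; have := rot_sym Hk Hl.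
move: (sym k l) (k ** l) => S p /(congr1 comp1) + /(congr1 comp1).
rewrite !(linE lin_comp1) !comp1_rot; move: (wt1_comp1 p) (wt1_comp1 S).
move: (comp1 p) (comp1 S) => m n Hm Hn En Em.
have E : rot (rot (rot m)) + (1 - 4%:R * c * c) *: (rot (rot m) - rot m) - m = 0.
  have := congr1 rot Em; rewrite !r En => Er.
  by apply: (linear_combination2 (k := 1) (k' := 1) Er Em); mcc.
have m0 : m = 0.
  have [Hr1 Hr2] := (wt1_rot Hm, wt1_rot2 Hm).
  rewrite (wt1_rot2 Hr1) Hr2 in E.
  have {}E : (2%:R * (1 - c) * (1 + 2%:R * c)) *: ((2%:R * c - 1) *: rot m - m) = 0.
    by rewrite -[RHS]E; mcc.
  have {}E : (2%:R * c - 1) *: rot m = m.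
    apply/eqP; rewrite -subr_eq0; apply/eqP; apply: scaler_cancel E.
    by rewrite !mulf_neq0 // natF0.
  have E' := congr1 rot E; rewrite !r Hr2 in E'.
  apply: (@scaler_cancel _ _ (2%:R * (1 - c))); first by rewrite mulf_neq0 ?natF0.
  apply: (linear_combination2 (k := 2%:R * c * (2%:R * c - 1) - 1)
    (k' := 1 - 2%:R * c) E E'); mcc.
(* With [m = 0], [rot n = - n]; as [c != -1], -1 is not an eigenvalue on [wt1]. *)
split=> //; rewrite m0 r !scaler0 sub0r in En.
apply: (@scaler_cancel _ _ (2%:R * (1 + c))); first by rewrite mulf_neq0 ?natF0.
have := wt1_rot2 Hn; rewrite En r En opprK => E'.
by apply: (linear_combination1 (k := 1) E'); mcc.
Qed.

Let comp0_sym k l : wt1 k -> wt1 l ->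
  comp0 (sym k l) = (2%:R * c) *: comp0 (k ** l).
Proof.
move=> Hk Hl; have := rot_sym Hk Hl.
move: (sym k l) (k ** l) => S p /(congr1 comp0).
rewrite !(linE lin_comp0) !comp0_rot => E.
by apply: (linear_combination1 (k := 2%:R^-1) E); mcc.
Qed.

(** The plane part of [sym k l] is twice the image of that of [k ** l] under R, where R sends [u0]
    to [u1] and [u1] to [2 c u1 - u0]. *)
Let half_rot k l := cs (sym k l) = - 2%:R * ct (k ** l) /\
  ct (sym k l) = 2%:R * cs (k ** l) + 4%:R * c * ct (k ** l).

Let symC k l : sym k l = sym l k.
Proof. by rewrite /sym addrC (mulC l) (mulC (rot l)). Qed.

Let half_rotC k l : half_rot k l -> half_rot l k.
Proof. by rewrite /half_rot symC mulC. Qed.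

Let half_rotD k k' l : half_rot k l -> half_rot k' l -> half_rot (k + k') l.
Proof.
rewrite /half_rot /sym !r !mulE !(csE, ctE) => -[E1 E2] [E3 E4].
split; first by transitivity ((cs (rot k ** l) + cs (k ** rot l)) +
  (cs (rot k' ** l) + cs (k' ** rot l))); [ring | rewrite E1 E3; ring].
by transitivity ((ct (rot k ** l) + ct (k ** rot l)) +
  (ct (rot k' ** l) + ct (k' ** rot l))); [ring | rewrite E2 E4; ring].
Qed.

(** The fusion rules at [a] and [b] express all plane coordinates of [y ** z] and [sym y z] by the
    single unknown [psi b (y ** z)]. *)
Let half_rot_fixed y z : wt1 y -> wt1 z -> tau a y = y -> tau a z = z ->
  [/\ half_rot y z, half_rot y (rot z), half_rot (rot y) z &
      half_rot (rot y) (rot z)].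
Proof.
move=> Hy Hz Ty Tz; have [Ky Kz] := (Hy.1, Hz.1).
have [[Ay By _] [Az Bz _]] := (Ky, Kz).
have [Ary Bry _] := perp_rot Ky; have [Arz Brz _] := perp_rot Kz.
have Tby : tau b y = rot y by rewrite tau_b_rot Ty.
have Tbz : tau b z = rot z by rewrite tau_b_rot Tz.
have Tbry : tau b (rot y) = y by rewrite -Tby tauK.
have Tbrz : tau b (rot z) = z by rewrite -Tbz tauK.
have [p pE] : exists p, p = y ** z by eexists.
have [S SE] : exists S, S = sym y z by eexists.
have f0p : psi a p = 0 by rewrite pE psi_mul_fixed.
have fmp : psi b (tau a p) = psi b p by rewrite pE tau_mul // Ty Tz.
have f2p : psi a (tau b p) = (2%:R + 2%:R * c) * psi b p.
  by have := psi_rel p; rewrite fmp f0p => /eqP; rewrite subr_eq => /eqP->; ring.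
have f1S : psi b S = - 2%:R * psi b p.
  (* [tau b] exchanges [y] with [rot y] and [z] with [rot z], so both sums lie in A_0 of [b]. *)
  have : psi b ((y + rot y) ** (z + rot z)) = 0.
    apply: psi_mul_fixed => //; rewrite ?tb ?psiE // ?By ?Bz ?Bry ?Brz ?addr0 //.
      by rewrite Tby Tbry addrC.
    by rewrite Tbz Tbrz addrC.
  have -> : (y + rot y) ** (z + rot z) = p + S + tau b p.
    by rewrite pE SE /sym tau_mul // Tby Tbz !mulE; mcc.
  by rewrite !psiE // psi_tau // => /eqP; rewrite addrAC addr_eq0 eq_sym eqr_oppLR => /eqP->; ring.
have skew w : wt1 w -> tau a w = w -> tau a (rot w - c *: w) = - (rot w - c *: w).
  by move=> Hw Tw; rewrite !ta tau_a_rot Tw wt1_rotV //; mcc.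
have f0S : psi a S = 0.
  have -> : S = (rot y - c *: y) ** z + y ** (rot z - c *: z) + (2%:R * c) *: p.
    by rewrite SE pE /sym !mulE; mcc.
  have sk1 : psi a (y ** (rot z - c *: z)) = 0 by apply: psi_mul_skew; rewrite ?skew.
  have sk2 : psi a ((rot y - c *: y) ** z) = 0.
    by rewrite mulC; apply: psi_mul_skew; rewrite ?skew.
  by rewrite !psiE // f0p sk1 sk2; ring.
have f2S : psi a (tau b S) = 0.
  by rewrite SE /sym !tb !tau_mul // Tby Tbz Tbry Tbrz addrC -/(sym y z) -SE.
have csp : cs p = - psi b p / (1 - c) by rewrite /cs f0p f2p; ffc.
have ctp : ct p = 0 by rewrite /ct csp f0p; ffc.
have csS : cs S = 0 by rewrite /cs f0S f2S; ffc.
have ctS : ct S = 2%:R * cs p by rewrite /ct csS csp f0S f1S; ffc.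
have [yrz ryz] : (cs (y ** rot z) = 0 /\ ct (y ** rot z) = cs p) /\
   (cs (rot y ** z) = 0 /\ ct (rot y ** z) = cs p).
  (* Weight 0 has no plane coordinates, so the two summands of [S] share theirs equally. *)
  have W : wt0 (y ** rot z - rot y ** z).
    by rewrite /wt0 !r !rM !wt1_rot2 // !mulE; mcc.
  have := cs_wt0 W; have := ct_wt0 W; have := csS; have := ctS.
  rewrite SE /sym !(csE, ctE).
  move=> E1 E2 /eqP; rewrite subr_eq0 => /eqP E3 /eqP; rewrite subr_eq0 => /eqP E4.
  rewrite -E3 in E1 *; rewrite -E4 in E2 *.
  have {}E1 : ct (y ** rot z) = cs p by apply: (mulfI (natF0 1)); rewrite -E1; ring.
  by have {}E2 : cs (y ** rot z) = 0 by apply: (mulfI (natF0 1)); rewrite mulr0 -E2; ring.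
have hyz : half_rot y z by rewrite /half_rot -SE -pE csS ctS ctp; split; ring.
have hyrz : half_rot y (rot z).
  rewrite /half_rot /sym (wt1_rot2 Hz) -rM -pE !mulE !(csE, ctE) cs_rot ct_rot.
  by rewrite -pE yrz.1 yrz.2 ctp; split; ring.
have hryz : half_rot (rot y) z.
  rewrite /half_rot /sym (wt1_rot2 Hy) -rM -pE !mulE !(csE, ctE) cs_rot ct_rot.
  by rewrite -pE ryz.1 ryz.2 ctp; split; ring.
split=> //.
rewrite /half_rot; have -> : sym (rot y) (rot z) = rot S by rewrite SE /sym r !rM.
by rewrite -rM -pE !(cs_rot, ct_rot) csS ctS ctp; split; ring.
Qed.

Let wt1_split k : wt1 k -> exists y z,
  [/\ wt1 y /\ wt1 z, tau a y = y, tau a z = z & k = y + rot z].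
Proof.
move=> Hk; have Ht := wt1_tau_a Hk.
have [d dE] : exists d, d = k - tau a k by eexists.
have Hd : wt1 d by rewrite dE -scaleN1r; apply: wt1D => //; apply: wt1Z.
have Td : tau a d = - d by rewrite dE !ta tauK //; mcc.
(* Chosen so that [d / 2 = rot z - c z]. *)
have [z zE] : exists z, z = (2%:R * (1 - c * c))^-1 *: (c *: d - rot d) by eexists.
have Hz : wt1 z.
  rewrite zE; apply: wt1Z; rewrite -scaleN1r.
  by apply: wt1D; apply: wt1Z => //; apply: wt1_rot.
have Tz : tau a z = z by rewrite zE !ta tau_a_rot Td ri wt1_rotV //; mcc.
exists (2%:R^-1 *: (k + tau a k) - c *: z), z; split=> //.
- split=> //; apply: wt1D; first by apply: wt1Z; apply: wt1D.
  by rewrite -scaleNr; apply: wt1Z.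
- by rewrite !ta tauK // Tz addrC [tau a k + k]addrC addrC.
- rewrite zE !r wt1_rot2 //.
  have kE : k = 2%:R^-1 *: (k + tau a k) + 2%:R^-1 *: d by rewrite dE; mcc.
  by rewrite {1}kE; mcc.
Qed.

Let half_rot_wt1 k l : wt1 k -> wt1 l -> half_rot k l.
Proof.
move=> /wt1_split[y [z [[Hy Hz] Ty Tz ->]]] /wt1_split[y' [z' [[Hy' Hz'] Ty' Tz' ->]]].
have [h1 h2 _ _] := half_rot_fixed Hy Hy' Ty Ty'.
have [_ h3 _ _] := half_rot_fixed Hy Hz' Ty Tz'.
have [_ _ h4 _] := half_rot_fixed Hz Hy' Tz Ty'.
have [_ _ _ h5] := half_rot_fixed Hz Hz' Tz Tz'.
by apply: half_rotD; apply: half_rotC; apply: half_rotD; apply: half_rotC.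
Qed.

(* The identity on weight 0, [al + be rot] on the weights 1 and -1, and
   [(al + be R) ^ 2] on the plane, where [R] is the half rotation [u0 |-> u1],
   with [R ^ 2 = rot]. *)
Definition torus al be v := locked (comp0 v + al *: comp1 v + be *: rot (comp1 v)
  + cs v *: ((al * al - be * be) *: u0 + (2%:R * al * be + 2%:R * c * be * be) *: u1)
  + ct v *: ((- (2%:R * al * be) - 2%:R * c * be * be) *: u0
     + (al * al + 4%:R * c * al * be + (4%:R * c * c - 1) * be * be) *: u1)).

(** The conic says that [al + be z] times its conjugate [al + be z^-1] is 1. Solved for [be * be],
    it serves [ring] as a rewriting rule. *)
Let conicE al be : al * al + 2%:R * c * al * be + be * be = 1 ->
  be * be = 1 - al * al - 2%:R * c * al * be.
Proof.
move=> N; transitivity (al * al + 2%:R * c * al * be + be * be - al * al -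
  2%:R * c * al * be); first by ring.
by rewrite N.
Qed.

(** * The torus acts by automorphisms *)

Section Torus.
Variables (al be : F).
Hypothesis norm1 : al * al + 2%:R * c * al * be + be * be = 1.

Let norm1' := conicE norm1.
Local Notation T := (torus al be).
Local Ltac mcn := mcoefs F; try by [ring | ring: norm1'].

Let lin_T : lin T.
Proof.
move=> k x y; rewrite /torus -!lock lin_comp0 lin_comp1 !r !csE !ctE; mcn.
Qed.
Let Tl := linE lin_T.

Let T_sum x m s t : wt0 x -> wt1 m -> T (x + m + s *: u0 + t *: u1) =
  x + al *: m + be *: rot m
  + s *: ((al * al - be * be) *: u0 + (2%:R * al * be + 2%:R * c * be * be) *: u1)
  + t *: ((- (2%:R * al * be) - 2%:R * c * be * be) *: u0
     + (al * al + 4%:R * c * al * be + (4%:R * c * c - 1) * be * be) *: u1).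
Proof.
by move=> Hx Hm; rewrite /torus -lock comp0_sum // comp1_sum // cs_sum // ct_sum.
Qed.

Let wt00 : wt0 0. Proof. by rewrite /wt0 r. Qed.

Let T_wt0 x : wt0 x -> T x = x.
Proof.
move=> Hx; have -> : x = x + 0 + 0 *: u0 + 0 *: u1 by mcc.
by rewrite (T_sum _ _ Hx wt10) ?r; mcc.
Qed.
Let T_wt1 m : wt1 m -> T m = al *: m + be *: rot m.
Proof.
move=> Hm; have {1}-> : m = 0 + m + 0 *: u0 + 0 *: u1 by mcc.
by rewrite (T_sum _ _ wt00 Hm); mcc.
Qed.
Let T_u0 : T u0 =
  (al * al - be * be) *: u0 + (2%:R * al * be + 2%:R * c * be * be) *: u1.
Proof.
have {1}-> : u0 = 0 + 0 + 1 *: u0 + 0 *: u1 by mcc.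
by rewrite (T_sum _ _ wt00 wt10) ?r; mcc.
Qed.
Let T_u1 : T u1 = (- (2%:R * al * be) - 2%:R * c * be * be) *: u0
     + (al * al + 4%:R * c * al * be + (4%:R * c * c - 1) * be * be) *: u1.
Proof.
have {1}-> : u1 = 0 + 0 + 0 *: u0 + 1 *: u1 by mcc.
by rewrite (T_sum _ _ wt00 wt10) ?r; mcc.
Qed.
Local Notation TuE := (T_u0, T_u1).

Let T_wt00 x y : wt0 x -> wt0 y -> T (x ** y) = T x ** T y.
Proof. by move=> Hx Hy; rewrite !T_wt0 // /wt0 rM Hx Hy. Qed.

Let T_wt01 x m : wt0 x -> wt1 m -> T (x ** m) = T x ** T m.
Proof.
move=> Hx Hm; have Hxm : wt1 (x ** m).
  by apply: wt1_intro; rewrite !rM !Hx wt1_rot2 // !mulE.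
by rewrite (T_wt0 Hx) !T_wt1 // rM Hx !mulE.
Qed.

Let T_wt0u x : wt0 x -> T (x ** u0) = T x ** T u0 /\ T (x ** u1) = T x ** T u1.
Proof.
move=> Hx; have [E0 E1] := wt0_mul Hx.
by rewrite (T_wt0 Hx) E0 E1 !Tl !TuE !mulE E0 E1; split; mcn.
Qed.

(** The right side is [al^2 p + al be S + be^2 rot p] with [p = k ** l] and [S = sym k l]. On the
    weight 0 part of [p] this is multiplication by the norm 1; on the plane part it is
    [(al + be R)^2]. *)
Let T_wt11 k l : wt1 k -> wt1 l -> T (k ** l) = T k ** T l.
Proof.
move=> Hk Hl; rewrite (T_wt1 Hk) (T_wt1 Hl).
have [E1 E2] := half_rot_wt1 Hk Hl; have [E3 E4] := comp1_mul Hk Hl.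
have E5 := comp0_sym Hk Hl.
have -> : (al *: k + be *: rot k) ** (al *: l + be *: rot l) =
  (al * al) *: (k ** l) + (al * be) *: sym k l + (be * be) *: rot (k ** l).
  by rewrite /sym rM !mulE; mcc.
move: (sym k l) (k ** l) E1 E2 E3 E4 E5 => S p E1 E2 E3 E4 E5.
rewrite [p]comp_sum [S]comp_sum E1 E2 E3 E4 E5.
move: (wt0_comp0 p) (cs p) (ct p); move: (comp0 p) => x Hx s t.
rewrite rot_sum // (T_sum _ _ Hx wt10).
by rewrite !r; mcn.
Qed.

Let T_wt1u m : wt1 m -> T (m ** u0) = T m ** T u0 /\ T (m ** u1) = T m ** T u1.
Proof.
move=> Hm; rewrite !TuE (T_wt1 Hm) !mulE !(mulC _ u0) !(mulC _ u1).
have [_ -> ->] := wt1_mul Hm; have [_ -> ->] := wt1_mul (wt1_rot Hm).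
have Hw := wt1_tau_a Hm; rewrite tau_a_rot !Tl.
have Hrw := wt1_rot Hw; rewrite (wt1_rotV Hw) !r wt1_rot2 //.
by rewrite (T_wt1 Hw) (T_wt1 Hrw) wt1_rot2 //; split; mcn.
Qed.

Let T_uu : [/\ T (u0 ** u0) = T u0 ** T u0, T (u0 ** u1) = T u0 ** T u1 &
  T (u1 ** u1) = T u1 ** T u1].
Proof.
have Te : T e = e by apply: T_wt0; apply: rot_e.
by rewrite !TuE !(mulE, uE) !Tl Te; split; mcn.
Qed.

Lemma torus_mul x y : T (x ** y) = T x ** T y.
Proof.
have [x0 [m [s [t [Hx Hm ->]]]]] := decomp x.
have [y0 [n [s' [t' [Hy Hn ->]]]]] := decomp y.
have [E1 E2] := T_wt0u Hx; have [E3 E4] := T_wt0u Hy.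
have [E5 E6] := T_wt1u Hm; have [E7 E8] := T_wt1u Hn.
have [E9 E10 E11] := T_uu.
have C p q : T (p ** q) = T p ** T q -> T (q ** p) = T q ** T p.
  by rewrite (mulC q) (mulC (T q)).
rewrite !(mulE, Tl) (T_wt00 Hx Hy) (T_wt01 Hx Hn) E1 E2.
rewrite (C _ _ (T_wt01 Hy Hm)) (T_wt11 Hm Hn) E5 E6.
rewrite (C _ _ E3) (C _ _ E7) E9 E10 (C _ _ E4) (C _ _ E8) (C _ _ E10) E11.
by mcc.
Qed.

Lemma torus_lin : lin T. Proof. exact: lin_T. Qed.

Lemma torus_axis : T a = 2%:R^-1 *: e +
  2%:R^-1 *: ((al * al - be * be) *: u0 + (2%:R * al * be + 2%:R * c * be * be) *: u1).
Proof. by rewrite aE !Tl T_u0 T_wt0 //; apply: rot_e. Qed.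

End Torus.

(** The inverse of [al + be z] is its conjugate [al + be z^-1], which equals
    [(al + 2 c be) - be z]. *)
Lemma torusK al be al' be' : al' = al + 2%:R * c * be -> be' = - be ->
  al * al + 2%:R * c * al * be + be * be = 1 ->
  cancel (torus al be) (torus al' be').
Proof.
move=> -> -> norm1.
have norm1' := conicE norm1.
move=> v; have [x [m [s [t [Hx Hm ->]]]]] := decomp v.
have E p q y n k h : wt0 y -> wt1 n -> torus p q (y + n + k *: u0 + h *: u1) =
  y + (p *: n + q *: rot n)
  + (k * (p * p - q * q) + h * (- (2%:R * p * q) - 2%:R * c * q * q)) *: u0
  + (k * (2%:R * p * q + 2%:R * c * q * q) +
     h * (p * p + 4%:R * c * p * q + (4%:R * c * c - 1) * q * q)) *: u1.
  move=> Hy Hn; rewrite /torus -lock comp0_sum // comp1_sum // cs_sum // ct_sum //.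
  by mcc.
rewrite !E //; last by apply: wt1_lin => //; apply: wt1Z; apply: wt1_rot.
by rewrite !r wt1_rot2 //; mcoefs F; try by [ring | ring: norm1'].
Qed.

Lemma aut_torus al be : al * al + 2%:R * c * al * be + be * be = 1 ->
  aut (torus al be).
Proof.
move=> N; split; first exact: torus_lin.
  by move=> x y; apply: torus_mul.
exists (torus (al + 2%:R * c * be) (- be)); first exact: torusK.
apply: torusK; rewrite ?opprK //; last by rewrite -[RHS]N; ring.
ring.
Qed.

(** Twice the [u0] coordinate of [torus al be a] is [al^2 - be^2]. This polynomial, with
    denominators cleared, vanishes at the parameters of the conic where that value is [l]. *)
Let conic_poly (l : F) : {poly F} := ('X^2 - 1) ^+ 2
  - ('X * (2%:R + (2%:R * c) *: 'X)) ^+ 2 - l *: ('X^2 + (2%:R * c) *: 'X + 1) ^+ 2.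

Let conic_polyE l z : (conic_poly l).[z] = (z ^+ 2 - 1) ^+ 2
  - (z * (2%:R + 2%:R * c * z)) ^+ 2 - l * (z ^+ 2 + 2%:R * c * z + 1) ^+ 2.
Proof. by rewrite /conic_poly !hornerE. Qed.

Let conic_poly_neq0 l : conic_poly l != 0.
Proof.
(* The value at 0 is [1 - l]; for [l = 1] the value at 1 is [- 8 (1 + c)^2]. *)
apply/eqP => E0; have := conic_polyE l 0; have := conic_polyE l 1.
rewrite E0 !horner0 => E1 E2; have l1 : l = 1.
  by apply/eqP; rewrite -subr_eq0 -oppr_eq0 [X in _ == X]E2; apply/eqP; ring.
have : 8%:R * (1 + c) * (1 + c) = 0 by rewrite -oppr0 E1 l1; ring.
by move/eqP; rewrite !mulf_eq0 (negPf (natF0 _)) (negPf cN1).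
Qed.

(* The points [((n ^ 2 - 1) / N, - 2 n (1 + c n) / N)], [N = n ^ 2 + 2 c n + 1],
   of the conic [al ^ 2 + 2 c al be + be ^ 2 = 1] are its intersections with the
   lines through [(1, 0)]. *)
Let axis_conic z : z ^+ 2 + 2%:R * c * z + 1 != 0 ->
  exists2 x, axis x & (conic_poly (2%:R * cs x)).[z] = 0.
Proof.
set N := _ + 1 => N0.
have NE : N = z ^+ 2 + 2%:R * c * z + 1 by [].
pose al := (z ^+ 2 - 1) / N; pose be := - z * (2%:R + 2%:R * c * z) / N.
have norm1 : al * al + 2%:R * c * al * be + be * be = 1.
  rewrite /al /be; move: N0; rewrite NE => N0; field; exact: N0.
exists (torus al be a); first by apply: axis_aut => //; apply: aut_torus.
rewrite conic_polyE -NE torus_axis // !csE cs_u0 cs_u1 cs_e /al /be.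
by field; rewrite N0 natF0.
Qed.

(** If a finite list held all axes, every natural number would be a root of the nonzero [q]: either
    the denominator vanishes there, or the parameter gives an axis in the list. *)
Lemma infinite_axes_circle : infinitely_many_axes mul.
Proof.
case=> l Hl.
pose q := ('X^2 + (2%:R * c) *: 'X + 1) *
  \prod_(x <- l) conic_poly (2%:R * cs x).
have q0 : q != 0.
  rewrite mulf_neq0 //; last first.
    by rewrite prodf_seq_neq0; apply/allP => x _; rewrite conic_poly_neq0.
  apply/eqP => /(congr1 (horner^~ 0)); rewrite /= !hornerE => E.
  have /eqP : (1 : F) = 0 by rewrite -[RHS]E; ring.
  by rewrite oner_eq0.
have Rq n : root q n%:R.
  rewrite rootM; apply/orP.
  case: (eqVneq (n%:R ^+ 2 + 2%:R * c * n%:R + 1 : F) 0) => [E|].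
    by left; rewrite rootE !hornerE E.
  move=> /axis_conic[x Hx Ex]; right.
  rewrite rootE horner_prod prodf_seq_eq0; apply/hasP; exists x; first exact: Hl.
  by rewrite /= Ex.
have := max_poly_roots q0 (rs := map (fun n => n%:R) (iota 0 (size q))).
rewrite size_map size_iota ltnn map_inj_uniq ?iota_uniq; last exact: natF_inj.
by move=> H; suff : false by []; apply: H => //; apply/allP => _ /mapP[n _ ->].
Qed.

End Circle.

(** * Trichotomy for pairs of axes *)

Lemma infinite_axes_generic a b : axis a -> axis b -> psi a b != 0 ->
  psi a b != 1 -> psi a b != 4%:R^-1 -> infinitely_many_axes mul.
Proof.
move=> Ha Hb; have [c cE] : exists c, c = 2%:R * psi a b - 1 by eexists.
have -> : psi a b = (c + 1) / 2%:R by rewrite cE; ff.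
move=> f0 f1 f4.
have cN1 : 1 + c != 0 by apply: contra_neq f0 => E; rewrite addrC E mul0r.
have c1 : c - 1 != 0.
  by apply: contra_neq f1 => /eqP; rewrite subr_eq0 => /eqP->; field; rewrite natF0.
have cNh : 1 + 2%:R * c != 0.
  apply: contra_neq f4 => E.
  have -> : c + 1 = 2%:R^-1 * (1 + 2%:R * c) + 2%:R^-1 by ff.
  by rewrite E; ff.
have fab : psi a b = (c + 1) / 2%:R by rewrite cE; ff.
have fba : psi b a = (c + 1) / 2%:R by rewrite psi_sym.
(* In the spin factor [a ** b = (c - 1) / 4 e + (a + b) / 2]; this is solved for the unit [e]. Then
   [mul_pair_sq], quadratic in [a ** b], gives [e ** e]. *)
have [e eE] : exists e, e = (4%:R / (c - 1)) *: (a ** b - 2%:R^-1 *: (a + b)).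
  by eexists.
have ae : a ** e = a.
  rewrite eE !mulE mul_axis_pair // fab axis_idem //.
  by mcoefs F; try by field; rewrite ?natF0 ?c1.
have be : b ** e = b.
  rewrite eE !mulE (mulC b a) (mulC a b) mul_axis_pair // fba axis_idem // (mulC b a).
  by mcoefs F; try by field; rewrite ?natF0 ?c1.
have ab : a ** b = ((c - 1) / 4%:R) *: e + 2%:R^-1 *: (a + b).
  by rewrite eE; mcoefs F; try by field; rewrite ?natF0 ?c1.
have ee : e ** e = e.
  have := mul_pair_sq Ha Hb; rewrite fab fba ab.
  rewrite !mulE !(mulC e a) !(mulC e b) (mulC b a) ae be ab (axis_idem Ha) (axis_idem Hb) => E.
  apply: (linear_combination1 (k := (16%:R / ((c - 1) * (c - 1)))) E).
  by mcoefs F; try by field; rewrite ?natF0 ?c1.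
apply: (@infinite_axes_circle a b e (2%:R *: a - e) (2%:R *: b - e) c) => //.
- by mc.
- by mc.
- by rewrite !mulE ee (mulC e a) ae.
- by rewrite !mulE ee (mulC e b) be.
- by rewrite !mulE ee (mulC e a) ae axis_idem //; mc.
- by rewrite !mulE ee (mulC e b) be axis_idem //; mc.
- by rewrite !mulE ee (mulC e b) ae be ab; mc.
Qed.

Lemma axes_trichotomy a b : ~ infinitely_many_axes mul -> axis a -> axis b ->
  [\/ a = b, a ** b = 0 | psi a b = 4%:R^-1].
Proof.
move=> fin Ha Hb.
case: (eqVneq a b) => [-> | ab]; first by constructor 1.
case: (eqVneq (a ** b) 0) => [-> | ab0]; first by constructor 2.
case: (eqVneq (psi a b) 4%:R^-1) => [-> | f4]; first by constructor 3.
case: fin; case: (eqVneq (psi a b) 0) => [f0 | f0].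
  exact: infinite_axes_psi0 ab0.
case: (eqVneq (psi a b) 1) => [f1 | f1]; first exact: infinite_axes_psi1 ab.
exact: infinite_axes_generic f4.
Qed.

Lemma tau_quarter a b : axis a -> axis b -> psi a b = 4%:R^-1 ->
  tau a b = a + b - 4%:R *: (a ** b).
Proof. by move=> Ha Hb E; rewrite tau_axis // E; mc. Qed.

Lemma tau_mul0 a b : a ** b = 0 -> tau a b = b.
Proof. by move=> E; rewrite tau_def E mulE; mc. Qed.

End Axes.

(** * The 3-transposition group *)

Section ThreeTranspositions.
Variables (X : finType) (tr : X -> X -> X).
Hypotheses (trK : forall c, involutive (tr c)) (trcc : forall c, tr c c = c).
Hypothesis tr_tr : forall c d x, tr c (tr d x) = tr (tr c d) (tr c x).
Hypothesis tr_alt : forall c d, (tr c d = d /\ tr d c = c) \/ tr c d = tr d c.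

Let isolated c := [forall x, tr c x == x].
Let isolatedP c : reflect (forall x, tr c x = x) (isolated c).
Proof. by apply: (iffP forallP) => H x; apply/eqP. Qed.

Let tr_inj c : injective (tr c). Proof. exact: inv_inj. Qed.

(** Otherwise [tr d c = tr c d = d = tr d d], which forces [c = d]. *)
Let isolated_tr c d : isolated c -> tr d c = c.
Proof.
move=> /isolatedP iso; case: (tr_alt d c) => [[]//|]; rewrite iso => E.
by have := E; rewrite -{2}(trcc d) => /tr_inj <-.
Qed.

(* The second component separates isolated points, on which [tr c] is trivial
   and hence does not determine [c]. *)
Definition refl_fun c (p : X * bool) := (tr c p.1, p.2 (+) (isolated c && (p.1 == c))).

Let flip_tr g x c : isolated c && (tr g x == c) = isolated c && (x == c).
Proof.
case iso: (isolated c) => //=.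
by rewrite -{1}(isolated_tr g iso) (inj_eq (@tr_inj g)).
Qed.

Let flip_trr g x c : isolated (tr g c) && (x == tr g c) = isolated c && (x == c).
Proof.
case iso: (isolated c); first by rewrite (isolated_tr g iso) iso.
case iso': (isolated (tr g c)) => //=.
have /esym := isolated_tr g iso'; rewrite trK => E.
by rewrite E iso in iso'.
Qed.

Let refl_funK c : involutive (refl_fun c).
Proof.
case=> x b; rewrite /refl_fun /= trK flip_tr -addbA addbb addbF //.
Qed.

Definition refl c : {perm X * bool} := perm (inv_inj (refl_funK c)).

Let reflE c p : refl c p = refl_fun c p. Proof. exact: permE. Qed.

Lemma refl_sq c : (refl c * refl c = 1)%g.
Proof. by apply/permP => p; rewrite permM !reflE refl_funK perm1. Qed.

Lemma reflV c : (refl c)^-1%g = refl c.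
Proof. by apply/eqP; rewrite eq_invg_mul refl_sq. Qed.

Lemma refl_conj c d : (refl c ^ refl d)%g = refl (tr d c).
Proof.
apply/permP => -[x b]; rewrite conjgE reflV !permM !reflE /refl_fun /=.
rewrite tr_tr trK; congr pair.
rewrite !flip_tr flip_trr.
by move: (isolated d && _) (isolated c && _); case: b => -[] [].
Qed.

(** The boolean recovers an isolated [c]. Otherwise some [x] is moved by both [c] and [d], so
    [tr x c = tr c x = tr d x = tr x d]. *)
Lemma refl_inj : injective refl.
Proof.
move=> c d E; have Ef p : refl_fun c p = refl_fun d p by rewrite -!reflE E.
case iso: (isolated c).
  have := congr1 snd (Ef (c, false)); rewrite /refl_fun /= iso eqxx /=.
  by move/esym/andP=> [_ /eqP].
have /forallPn[x /eqP Hx] := negbT iso.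
have Hx' : tr d x <> x by have /(congr1 fst) /= <- := Ef (x, false).
have /(congr1 fst) /= Ecd := Ef (x, false).
case: (tr_alt c x) => [[//]|Ec]; case: (tr_alt d x) => [[//]|Ed].
by apply: (@tr_inj x); rewrite -Ec -Ed.
Qed.

Lemma order_refl c : #[refl c]%g = 2%N.
Proof.
apply: nt_prime_order => //; first by rewrite expgS expg1 refl_sq.
apply/eqP => E; have Ef p : refl_fun c p = p by rewrite -reflE E perm1.
have iso : isolated c by apply/isolatedP => x; have /(congr1 fst) := Ef (x, false).
by have /(congr1 snd) := Ef (c, false); rewrite /= iso eqxx.
Qed.

Let refl_mul_neq1 c d : c != d -> (refl c * refl d != 1)%g.
Proof. by apply: contra_neq => /eqP; rewrite -eq_invg_mul reflV => /eqP/refl_inj. Qed.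

Lemma order_refl2 c d : c != d -> tr d c = c -> #[(refl c * refl d)%g]%g = 2%N.
Proof.
move=> cd E; apply: nt_prime_order => //; last exact: refl_mul_neq1.
have cm : (refl c * refl d = refl d * refl c)%g.
  by rewrite (conjgC (refl c)) refl_conj E.
by rewrite expgS expg1 {2}cm mulgA -(mulgA (refl c)) refl_sq mulg1 refl_sq.
Qed.

Lemma order_refl3 c d : c != d -> tr c d = tr d c ->
  #[(refl c * refl d)%g]%g = 3%N.
Proof.
move=> cd E; apply: nt_prime_order => //; last exact: refl_mul_neq1.
have := refl_conj c d; rewrite -E -refl_conj !conjgE !reflV !mulgA => braid.
rewrite !expgS expg0 mulg1 !mulgA -braid -(mulgA _ (refl d) (refl d)) refl_sq.
by rewrite mulg1 -(mulgA _ (refl c) (refl c)) refl_sq mulg1 refl_sq.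
Qed.

Definition refl_set : {set {perm X * bool}} := [set refl c | c in X].

Lemma refl_three_transposition : three_transposition <<refl_set>>%G refl_set.
Proof.
split=> //=; first exact: subset_gen.
- by move=> _ /imsetP[c _ ->]; apply: order_refl.
- move=> d g Dd; suff /fintype.subsetP N : <<refl_set>>%g \subset 'N(refl_set)%g.
    by move=> /N/normP <-; rewrite memJ_conjg.
  rewrite gen_subG; apply/fintype.subsetP => _ /imsetP[c _ ->]; rewrite inE.
  apply/fintype.subsetP => _ /imsetP[_ /imsetP[x _ ->] ->]; rewrite refl_conj.
  by apply: imset_f.
- move=> _ _ /imsetP[c _ ->] /imsetP[d _ ->].
  case: (eqVneq c d) => [-> | cd]; first by rewrite refl_sq order1.
  by case: (tr_alt c d) => [[_ E]|E]; [rewrite order_refl2 | rewrite order_refl3].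
Qed.

End ThreeTranspositions.

(** * The map from the Matsuo algebra onto the algebra *)

Section MatsuoQuotient.
Variables (F : fieldType) (V : lmodType F) (mul : V -> V -> V).
Hypothesis charF0 : [pchar F] =i pred0.
Hypothesis mulA : jordan_half_algebra mul.
Variables (X : finType) (ax : X -> V) (tr : X -> X -> X).
Hypotheses (ax_inj : injective ax)
  (ax_axis : forall x, primitive_axis_half mul (ax x))
  (ax_onto : forall v, primitive_axis_half mul v -> exists x, ax x = v)
  (ax_tr : forall c x, ax (tr c x) = tau mul (ax c) (ax x))
  (ax_alt : forall c d, [\/ ax c = ax d, mul (ax c) (ax d) = 0 |
     psi mul (ax c) (ax d) = 4%:R^-1]).

Let mulC x y : mul x y = mul y x. Proof. by case: mulA => -[]. Qed.
Let mE := mulE mulA.1.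

Let trK c : involutive (tr c).
Proof. by move=> x; apply: ax_inj; rewrite !ax_tr (tauK charF0 mulA.1). Qed.
Let trcc c : tr c c = c.
Proof. by apply: ax_inj; rewrite ax_tr tau_self. Qed.
Let tr_tr c d x : tr c (tr d x) = tr (tr c d) (tr c x).
Proof.
by apply: ax_inj; rewrite !ax_tr (tau_aut _ _ (aut_tau charF0 mulA.1 (ax_axis c))).
Qed.

Let tr_quarter c d : psi mul (ax c) (ax d) = 4%:R^-1 ->
  ax (tr c d) = ax c + ax d - 4%:R *: mul (ax c) (ax d).
Proof. by move=> E; rewrite ax_tr (tau_quarter charF0 mulA.1). Qed.

Let tr_comm c d : mul (ax c) (ax d) = 0 -> tr c d = d.
Proof. by move=> E; apply: ax_inj; rewrite ax_tr (tau_mul0 mulA.1). Qed.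

Let tr_alt c d : (tr c d = d /\ tr d c = c) \/ tr c d = tr d c.
Proof.
case: (ax_alt c d) => [/ax_inj<- | E | E]; first by right.
  by left; split; apply: tr_comm => //; rewrite mulC.
right; apply: ax_inj; rewrite !tr_quarter //; last by rewrite (psi_sym charF0 mulA.1).
by rewrite mulC [ax c + _]addrC.
Qed.

Local Notation rfl := (refl trK trcc tr_alt).
Local Notation D := (refl_set trK trcc tr_alt).

Let in_D x : rfl x \in D. Proof. exact: imset_f. Qed.
Let dt x : Dt D := Sub (rfl x) (in_D x).

Let dt_inj : injective dt.
Proof. by move=> x y /(congr1 val) /= /refl_inj. Qed.
Let dt_bij : bijective dt.
Proof.
apply: inj_card_bij => //; rewrite card_sig.
by rewrite (eq_card (B := D)) // card_imset //; apply: refl_inj.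
Qed.

(** The linear map taking the basis vector of [refl x] to the axis [ax x]. *)
Let phi (f : matsuo_space F D) : V := \sum_x (f (dt x) : F) *: ax x.

Let phi_lin k f g : phi (k *: f + g) = k *: phi f + phi g.
Proof.
rewrite /phi scaler_sumr -big_split; apply: eq_bigr => x _ /=.
by rewrite !ffunE scalerA -scalerDl.
Qed.

Let phi_sum (I : finType) (h : I -> matsuo_space F D) :
  phi (\sum_i h i) = \sum_i phi (h i).
Proof.
have phiD f g : phi (f + g) = phi f + phi g.
  by rewrite -[f]scale1r phi_lin !scale1r.
apply: big_morph => //.
by rewrite -[0](subrr 0) -scaleN1r addrC phi_lin scaleN1r addNr.
Qed.

Let phi0 : phi 0 = 0.
Proof. by rewrite -[0](subrr 0) -scaleN1r addrC phi_lin scaleN1r addNr. Qed.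
Let phiZ k f : phi (k *: f) = k *: phi f.
Proof. by rewrite -[_ *: _]addr0 phi_lin phi0 addr0. Qed.

Let phi_basis x : phi (mbasis F D (rfl x)) = ax x.
Proof.
rewrite /phi (bigD1 x) //= ffunE eqxx scale1r big1 ?addr0 // => y yx.
by rewrite ffunE (inj_eq (@refl_inj _ _ _ _ _)) (negPf yx) scale0r.
Qed.

Let phi_basis_prod x y :
  phi (matsuo_basis_prod F (dt x) (dt y)) = mul (ax x) (ax y).
Proof.
rewrite /matsuo_basis_prod (inj_eq dt_inj).
case: eqVneq => [<-|xy]; first by rewrite phi_basis (axis_idem (ax_axis x)).
case: (ax_alt x y) => [/ax_inj E | E | E]; first by rewrite E eqxx in xy.
  by rewrite order_refl2 //= ?phi0 ?E //; apply: tr_comm; rewrite mulC.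
have Etr : tr x y = tr y x.
  apply: ax_inj; rewrite !tr_quarter //; last by rewrite (psi_sym charF0 mulA.1).
  by rewrite mulC [ax x + _]addrC.
rewrite order_refl3 //= refl_conj // phiZ -scaleN1r addrC phi_lin.
rewrite -[mbasis F D (rfl x)]scale1r phi_lin scale1r !phi_basis -Etr tr_quarter //.
by mcoefs F; field; rewrite ?(natF_neq0 charF0).
Qed.

Let mul_sum (I J : finType) (f : I -> V) (g : J -> V) :
  mul (\sum_i f i) (\sum_j g j) = \sum_i \sum_j mul (f i) (g j).
Proof.
have -> : mul (\sum_i f i) (\sum_j g j) = \sum_i mul (f i) (\sum_j g j).
  by apply: (big_morph (mul^~ _)) => [x y|]; rewrite mE.
by apply: eq_bigr => i _; apply: (big_morph (mul _)) => [x y|]; rewrite mE.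
Qed.

Let phi_mul f g : phi (matsuo_mul f g) = mul (phi f) (phi g).
Proof.
rewrite /matsuo_mul phi_sum (reindex dt) /=; last exact: onW_bij dt_bij.
rewrite {2 3}/phi mul_sum; apply: eq_bigr => x _.
rewrite phi_sum (reindex dt) /=; last exact: onW_bij dt_bij.
apply: eq_bigr => y _; rewrite phiZ phi_basis_prod !mE scalerA.
by [].
Qed.

Lemma matsuo_quotient : exists (gT : finGroupType) (G : {group gT}) (D : {set gT}),
  three_transposition G D /\ exists I : matsuo_space F D -> Prop,
    alg_factor_iso (@matsuo_mul F gT D) mul I.
Proof.
exists {perm X * bool}, <<D>>%G, D; split; first exact: refl_three_transposition.
exists (fun f => phi f = 0); split.
  split; first split=> [|f g f0 g0|k f f0] //.
  - by rewrite -[f]scale1r phi_lin f0 g0 scaler0 addr0.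
  - by rewrite phiZ f0 scaler0.
  - by move=> f g g0; rewrite phi_mul g0 mE.
(* The image of [phi] is a subalgebra containing all axes, and these generate. *)
exists phi; split=> //; apply: mulA.2.
  split; first split=> [|_ _ [f <-] [g <-]|k _ [f <-]]; first by exists 0.
  - by exists (1 *: f + g); rewrite phi_lin scale1r.
  - by exists (k *: f); rewrite phiZ.
  - by move=> _ _ [f <-] [g <-]; exists (matsuo_mul f g); rewrite phi_mul.
by move=> v /ax_onto[x <-]; exists (mbasis F D (rfl x)); rewrite phi_basis.
Qed.

End MatsuoQuotient.

Theorem theorem3 (F : fieldType) (V : lmodType F) (mul : V -> V -> V)
    (charF0 : [pchar F] =i pred0)
    (hA : jordan_half_algebra mul) :
  infinitely_many_axes mul \/
  exists (gT : finGroupType) (G : {group gT}) (D : {set gT}),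
    three_transposition G D /\
    (alg_isomorphic (@matsuo_mul F gT D) mul \/
     exists I : matsuo_space F D -> Prop, alg_factor_iso (@matsuo_mul F gT D) mul I).
Proof.
case: (pselect (infinitely_many_axes mul)) => [|fin]; [by left | right].
have [l Hl] : exists s : seq V, forall x, primitive_axis_half mul x -> x \in s.
  exact: contrapT fin.
(* [l] may contain other vectors; after filtering, [seq_sub l'] is the finite type of axes. *)
pose l' := [seq v <- l | `[< primitive_axis_half mul v >]].
have l'P v : primitive_axis_half mul v <-> v \in l'.
  rewrite mem_filter; split=> [Hv | /andP[/asboolP]//].
  by apply/andP; split; [apply/asboolP | apply: Hl].
have axisP (x : seq_sub l') : primitive_axis_half mul (val x).
  by apply/l'P; apply: valP.
have trP (c x : seq_sub l') : tau mul (val c) (val x) \in l'.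
  by apply/l'P; exact: (axis_aut (aut_tau charF0 hA.1 (axisP c)) (axisP x)).
pose tr (c x : seq_sub l') : seq_sub l' := Sub (tau mul (val c) (val x)) (trP c x).
have onto v : primitive_axis_half mul v -> exists x : seq_sub l', val x = v.
  by move=> /l'P Hv; exists (SeqSub Hv).
have alt (c d : seq_sub l') := 
  axes_trichotomy charF0 hA.1 hA.2 fin (axisP c) (axisP d).
have [gT [G [D [H3 HI]]]] :=
  @matsuo_quotient _ _ _ charF0 hA _ val tr val_inj axisP onto (fun c x => erefl) alt.
(* A Matsuo algebra itself is its factor by the zero ideal, so this alternative covers both. *)
by exists gT, G, D; split=> //; right.
Qed.
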